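(* Let $2<p<\infty$. Let $b\colon[-1,1]\to\mathbb{R}$ be continuously differentiable, let $\varphi\colon[-1,1]\times\mathbb{R}\to\mathbb{R}$, $(x,u)\mapsto\varphi(x,u)$, be such that both $\varphi$ and $\frac{\partial\varphi}{\partial u}$ are continuous on $[-1,1]\times\mathbb{R}$, and assume that $$\tfrac12\, b'(x)+\frac{\partial\varphi}{\partial u}(x,s)\ge 0\qquad\text{for all }(x,s)\in(-1,1)\times\mathbb{R}.$$ Let $f,g\in L^\infty(-1,1)$ satisfy $f\le g$ a.e. in $(-1,1)$, and let $u,v\colon[-1,1]\to\mathbb{R}$ be solutions of $$-\left(|u'|^{p-2}u'\right)'-b(x)\,u'+\varphi(x,u)=f(x),\qquad -\left(|v'|^{p-2}v'\right)'-b(x)\,v'+\varphi(x,v)=g(x)\qquad\text{in }(-1,1),$$ with $u(-1)\le v(-1)$ and $u(1)\le v(1)$. Then $u\le v$ holds everywhere in $[-1,1]$.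
   Context: Solutions are understood in the usual weak sense: $u\in W^{1,p}(-1,1)$ satisfies the equation in the sense of distributions. In one dimension, $u$ then has a continuously differentiable representative on $[-1,1]$, $|u'|^{p-2}u'$ is absolutely continuous, and the equation holds a.e. in $(-1,1)$. *)

(* Defs.v *)
From HB Require Import structures.
From mathcomp Require Import all_boot all_order all_algebra.
From mathcomp Require Import all_classical all_reals all_analysis.

Set Implicit Arguments.
Unset Strict Implicit.
Unset Printing Implicit Defensive.

Import Order.TTheory GRing.Theory Num.Theory.
Import numFieldNormedType.Exports.

Local Open Scope ring_scope.
Local Open Scope classical_set_scope.

(* The difference quotient ranges over A only, so the derivative is one-sided
   at the endpoints of an interval. *)
Definition continuously_differentiable_on (R : realType) (A : set R)
    (h : R -> R) : Prop :=
  exists2 dh : R -> R, {within A, continuous dh} &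
    forall x, A x ->
      (h y - h x) / (y - x) @[y --> within A x^'] --> dh x.

(* L^q(D) for 1 <= q <= +oo; a function on D is represented by a function on R
   whose values outside D are irrelevant, as h \_ D is the extension by 0. *)
Definition Lebesgue_space (R : realType) (D : set R) (q : \bar R)
    (h : R -> R) : Prop :=
  h \_ D \in Lfun (@lebesgue_measure R) q.

(* C_c^oo(D) *)
Definition test_function (R : realType) (D : set R) (eta : R -> R) : Prop :=
  [/\ forall (n : nat) (x : R), derivable (eta^`(n)) x 1,
      compact (closure [set x | eta x != 0]) &
      closure [set x | eta x != 0] `<=` D].

Definition weak_derivative (R : realType) (D : set R) (h dh : R -> R) : Prop :=
  forall eta : R -> R, test_function D eta ->
    (\int[@lebesgue_measure R]_(x in D) (h x * eta^`()%classic x) =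
     - \int[@lebesgue_measure R]_(x in D) (dh x * eta x)).

(* h belongs to W^{1,q}(D) and dh is its weak derivative *)
Definition Sobolev_W1 (R : realType) (D : set R) (q : R)
    (h dh : R -> R) : Prop :=
  [/\ Lebesgue_space D q%:E h, Lebesgue_space D q%:E dh &
      weak_derivative D h dh].

(* u is a solution of - (|u'|^{p-2} u')' - b u' + phi(x, u) = f in the sense of
   distributions on ]-1, 1[: both sides are tested against C_c^oo functions,
   the distributional derivative of the flux being transferred to eta.
   Elements of W^{1,p}(-1,1) are classes modulo a.e. equality; pointwise values
   of u on [-1, 1] refer to the continuous representative. *)
Definition weak_solution (R : realType) (p : R) (b : R -> R)
    (phi : R -> R -> R) (f u : R -> R) : Prop :=
  {within `[-1, 1], continuous u} /\
  exists2 du : R -> R, Sobolev_W1 `]-1, 1[%classic p u du &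
    forall eta : R -> R, test_function `]-1, 1[%classic eta ->
      (\int[@lebesgue_measure R]_(x in `]-1, 1[)
          (`|du x| `^ (p - 2) * du x * eta^`()%classic x)
       - \int[@lebesgue_measure R]_(x in `]-1, 1[) (b x * du x * eta x)
       + \int[@lebesgue_measure R]_(x in `]-1, 1[) (phi x (u x) * eta x)
       = \int[@lebesgue_measure R]_(x in `]-1, 1[) (f x * eta x)).

(* Main.v *)
(* The primitives of the equations show that |u'|^(p-2) u' and |v'|^(p-2) v' have
   absolutely continuous representatives, so that u and v are C^1 on ]-1, 1[.
   Let A t = |t|^(p-2) t, z = u - v and F = A u' - A v'.  On a component ]a, c[
   of {z > 0}, testing with z amounts to following the function
   E = F z + b z^2 / 2: formally
   E' = F z' + z (g - f) + z (phi(x, u) - phi(x, v) + b' z / 2) >= F z' >= 0,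
   the last bracket being handled by the mean value theorem.  Since E vanishes
   at a and c, it is constant, whereas A is strictly increasing and z' > 0
   somewhere in ]a, c[: a contradiction.  As f and g are only bounded, E need not
   be differentiable, and the monotonicity is obtained from lower right Dini
   derivatives. *)

Require Import Defs.
From HB Require Import structures.
From mathcomp Require Import all_boot all_order all_algebra.
From mathcomp Require Import ring lra.
From mathcomp Require Import all_classical all_reals all_analysis.
From mathcomp Require Import measurable_realfun ess_sup_inf.

Import Order.TTheory GRing.Theory Num.Theory.
Import numFieldNormedType.Exports.

Local Open Scope ring_scope.
Local Open Scope classical_set_scope.

Set Implicit Arguments.
Unset Strict Implicit.
Unset Printing Implicit Defensive.

(** The quadratic term of E is dictated by the drift: formally F' = phi(x, u) - phi(x, v) - b z' +
    (g - f), and the derivative b z z' + b' z^2 / 2 of b z^2 / 2 cancels the term - b z z' of F' z.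
    The data f and g enter only through the monotonicity of F - K, where K is a primitive of the
    continuous part of F'. To the right of a point x, and where z > 0, replacing F y by F x + K y -
    K x can only lower the energy, and it leaves a function differentiable at x. This is how a Dini
    derivative is computed by ordinary calculus. The regularity has to come from C_c^oo tests alone.
    Test functions are obtained as primitives of combinations of exp(-1/x) bumps with mean zero, and
    they lead to the du Bois-Reymond lemma. The latter needs integration by parts for a primitive of
    a merely integrable function, which need not be differentiable everywhere; an estimate on
    increments takes the place of the product rule. *)

Definition smooth (R : realType) (f : R -> R) : Prop :=
  forall (n : nat) (x : R), derivable (f^`(n)) x 1.

(** Finite order turns closure under products into an induction: both terms of (f g)' are products
    of functions that are smooth to one order less. *)
Fixpoint nsmooth (R : realType) (n : nat) (f : R -> R) : Prop :=
  if n is m.+1 then (forall x, derivable f x 1) /\ nsmooth m f^`() else True.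

(** * Smooth functions, and flat functions built on exp(-1/x) *)

Section smooth.
Context {R : realType}.
Implicit Types f g : R -> R.

Lemma nsmoothP f : smooth f <-> forall n, nsmooth n f.
Proof.
split=> [sf n|nf n x].
  elim: n f sf => //= n IH f sf; split; first by move=> x; exact: (sf 0%N).
  by apply: IH => m x; rewrite -derive1Sn; exact: sf.
elim: n f nf => [f nf|n IH f nf]; first by have [/(_ x)] := nf 1%N.
by rewrite derive1Sn; apply: IH => m; have [] := nf m.+1.
Qed.

Lemma nsmoothS n f : nsmooth n.+1 f -> nsmooth n f.
Proof. by elim: n f => // n IH f [df sf]; split => //; exact: IH. Qed.

Lemma nsmoothD n f g : nsmooth n f -> nsmooth n g -> nsmooth n (f \+ g).
Proof.
elim: n f g => //= n IH f g [df sf] [dg sg]; split.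
  by move=> x; exact: derivableD.
suff -> : (f \+ g)^`() = f^`() \+ g^`() by exact: IH.
by apply/funext => x; rewrite /= !derive1E deriveD.
Qed.

Lemma nsmoothM n f g : nsmooth n f -> nsmooth n g -> nsmooth n (f \* g).
Proof.
elim: n f g => // n IH f g sf sg.
have [df sf'] := sf; have [dg sg'] := sg; split.
  by move=> x; exact: derivableM.
suff -> : (f \* g)^`() = (f \* g^`()) \+ (f^`() \* g).
  by apply: nsmoothD; apply: IH => //; exact: nsmoothS.
apply/funext => x; rewrite /= !derive1E deriveM//.
by rewrite [X in _ + X]mulrC.
Qed.

Lemma nsmooth_cst n (c : R) : nsmooth n (cst c : R -> R).
Proof.
elim: n c => // n IH c; split; first by move=> x; exact: derivable_cst.
suff -> : (cst c : R -> R)^`() = cst 0 by exact: IH.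
by apply/funext => x; rewrite derive1_cst.
Qed.

Lemma nsmooth_affine n f (c d : R) :
  nsmooth n f -> nsmooth n (fun x => f (c * x + d)).
Proof.
elim: n f => //= n IH f [df sf].
have H (x : R) : is_derive x 1 (fun x => f (c * x + d)) (f^`()%classic (c * x + d) * c).
  have /derivableP fx := df (c * x + d); rewrite derive1E.
  apply: (@is_derive1_comp R f (fun x => c * x + d)).
  rewrite (_ : (fun y => c * y + d) = c \*: id + cst d)//.
  by apply: is_derive_eq; rewrite addr0 /GRing.scale/= mulr1.
split; first by move=> x; case: (H x).
suff -> : (fun x => f (c * x + d))^`() = (fun x => f^`()%classic (c * x + d)) \* cst c.
  by apply: nsmoothM; [exact: IH|exact: nsmooth_cst].
by apply/funext => x; rewrite derive1E; case: (H x).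
Qed.

Lemma smooth_affine f (c d : R) : smooth f -> smooth (fun x => f (c * x + d)).
Proof. by move=> /nsmoothP sf; apply/nsmoothP => n; exact: nsmooth_affine. Qed.

Lemma smoothD f g : smooth f -> smooth g -> smooth (f \+ g).
Proof.
by move=> /nsmoothP sf /nsmoothP sg; apply/nsmoothP => n; exact: nsmoothD.
Qed.

Lemma smoothM f g : smooth f -> smooth g -> smooth (f \* g).
Proof.
by move=> /nsmoothP sf /nsmoothP sg; apply/nsmoothP => n; exact: nsmoothM.
Qed.

Lemma smooth_cst (c : R) : smooth (cst c : R -> R).
Proof. by apply/nsmoothP => n; exact: nsmooth_cst. Qed.

Lemma smooth_primitive f g : (forall x : R, is_derive x 1 g (f x)) -> smooth f ->
  smooth g.
Proof.
move=> gf sf [|n] x; first exact: ex_derive.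
rewrite derive1Sn (_ : g^`() = f); first exact: sf.
by apply/funext => y; rewrite derive1E derive_val.
Qed.

Lemma smooth_derivable f (x : R) : smooth f -> is_derive x 1 f (f^`()%classic x).
Proof. by move=> sf; rewrite derive1E; apply/derivableP/(sf 0%N). Qed.

Lemma smooth_continuous f : smooth f -> continuous f.
Proof.
by move=> sf x; exact/differentiable_continuous/derivable1_diffP/(sf 0%N).
Qed.

Lemma smooth_derive f : smooth f -> smooth f^`().
Proof. by move=> sf n x; rewrite -derive1Sn; exact: sf. Qed.

(** In the Horner step, the factor [y] is paid for by half of the exponent, through k y / 2 <= exp(k
    y / 2); hence the induction is for all [k] at once. *)
Lemma poly_expR_bound (p : {poly R}) (k : R) : 0 < k ->
  exists2 C, 0 <= C & forall y, 0 <= y -> `|p.[y]| <= C * expR (k * y).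
Proof.
elim/poly_ind: p k => [|p c IH] k k0.
  by exists 0 => // y _; rewrite horner0 normr0 mul0r.
have k20 : 0 < k / 2 by rewrite divr_gt0.
have [C C0 pC] := IH _ k20.
exists (C * (k / 2)^-1 + `|c|).
  by rewrite addr_ge0// mulr_ge0// invr_ge0 ltW.
move=> y y0; rewrite hornerMXaddC (le_trans (ler_normD _ _))// mulrDl lerD//.
  rewrite normrM (ger0_norm y0) [X in expR (X * y)](splitr k) mulrDl expRD.
  rewrite mulrACA ler_pM// ?pC//.
  rewrite ler_pdivlMl// (le_trans _ (expR_ge1Dx _))//.
  by rewrite lerDr ler01.
by rewrite ler_peMr// -expR0 ler_expR mulr_ge0// ltW.
Qed.

(** The classical flat function exp(-1/x), with a polynomial in 1/x in front so that the family is
    closed under differentiation. *)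
Definition flat_fun (p : {poly R}) (x : R) : R :=
  if 0 < x then p.[x^-1] * expR (- x^-1) else 0.

Lemma is_derive_flat_fun (p : {poly R}) (x : R) :
  is_derive x 1 (flat_fun p) (flat_fun ('X^2 * (p - p^`())) x).
Proof.
have [x0|x0|->] := ltgtP x 0.
- rewrite {2}/flat_fun ltNge (ltW x0)/=.
  apply: (@near_eq_is_derive _ _ _ (cst 0)) => //.
  near=> y; rewrite /flat_fun ifF//; apply/negbTE; rewrite -leNgt.
  by near: y; exact: lt_le_nbhsl.
- rewrite {2}/flat_fun x0/=.
  pose F (y : R) : R := p.[y^-1] * expR (- y^-1).
  apply: (@near_eq_is_derive _ _ _ F).
    near=> y; rewrite /flat_fun ifT//.
    by near: y; exact: lt_nbhsr.
  have xn0 : x != 0 by rewrite gt_eqF.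
  have dV : is_derive x 1 (fun y : R => y^-1) (- x ^- 2).
    apply: is_derive_eq; first exact: (@is_deriveV _ id).
    by rewrite /= scaler1.
  have dp : is_derive x 1 (fun y : R => p.[y^-1]) (p^`().[x^-1] * - x ^- 2).
    exact: (@is_derive1_comp _ (horner p) (fun y => y^-1)).
  have dN : is_derive x 1 (fun y : R => - y^-1) (x ^- 2).
    by apply: is_derive_eq; rewrite opprK.
  have de : is_derive x 1 (fun y : R => expR (- y^-1)) (expR (- x^-1) * x ^- 2).
    exact: (@is_derive1_comp _ expR (fun y => - y^-1)).
  apply: (is_derive_eq (is_deriveM dp de)).
  rewrite /= /GRing.scale/= hornerM hornerD hornerN hornerXn exprVn; ring.
- rewrite {2}/flat_fun ltxx.
  (* At y = 1/h the two extra powers of [y] give |flat_fun p h| <= C h^2, so that the difference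
     quotient at 0 is at most C |h|. *)
  have [C C0 pC] := @poly_expR_bound (p * 'X^2) 1 ltr01.
  have H h : `|flat_fun p h| <= C * h ^+ 2.
    rewrite /flat_fun; case: ifPn => h0; last first.
      by rewrite normr0 mulr_ge0// sqr_ge0.
    have := pC h^-1; rewrite invr_ge0 (ltW h0) => /(_ isT).
    rewrite mul1r hornerM hornerXn normrM [`|_ ^+ 2|]ger0_norm ?sqr_ge0//.
    rewrite normrM [`|expR _|]gtr0_norm ?expR_gt0//.
    rewrite -(@ler_pM2r _ (expR (- h^-1) * h ^+ 2)); last first.
      by rewrite mulr_gt0 ?expR_gt0// exprn_gt0.
    have e1 : expR h^-1 * expR (- h^-1) = 1 by rewrite -expRD subrr expR0.
    have e2 : h^-1 ^+ 2 * h ^+ 2 = 1 by rewrite -exprMn mulVf ?gt_eqF// expr1n.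
    rewrite [leLHS](_ : _ = `|p.[h^-1]| * expR (- h^-1) * (h^-1 ^+ 2 * h ^+ 2)); last by ring.
    rewrite [leRHS](_ : _ = C * h ^+ 2 * (expR h^-1 * expR (- h^-1))); last by ring.
    by rewrite e1 e2 !mulr1.
  have f0 : flat_fun p 0 = 0 by rewrite /flat_fun ltxx.
  suff K : h^-1 *: (flat_fun p (h *: 1 + 0) - flat_fun p 0) @[h --> 0^'] --> (0 : R).
    by apply: DeriveDef; [apply/cvg_ex; exists 0|apply/cvg_lim].
  apply/cvgrPdist_le => e e0; near=> h.
  rewrite f0 sub0r normrN addr0 subr0 /GRing.scale/= mulr1 normrM normfV.
  have hn0 : h != 0 by near: h; exact: nbhs_dnbhs_neq.
  rewrite ler_pdivrMl ?normr_gt0// (le_trans (H h))//.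
  rewrite -(real_normK (num_real h)) expr2 mulrC -mulrA ler_wpM2l//.
  have : `|h| <= e / (C + 1).
    near: h; apply: dnbhs0_le; rewrite divr_gt0// ltr_wpDl//.
  rewrite ler_pdivlMr ?ltr_wpDl//; apply: le_trans.
  by rewrite ler_wpM2l// lerDl ler01.
Unshelve. all: by end_near. Qed.

Lemma smooth_flat_fun (p : {poly R}) : smooth (flat_fun p).
Proof.
move=> n; elim: n p => [|n IH] p x; first by case: (is_derive_flat_fun p x).
rewrite derive1Sn.
suff -> : (flat_fun p)^`() = flat_fun ('X^2 * (p - p^`())) by exact: IH.
by apply/funext => y; rewrite derive1E; case: (is_derive_flat_fun p y).
Qed.

End smooth.

(** * Integrability and integrals of real functions on intervals *)

Section integrals.
Context {R : realType}.
Notation mu := (@lebesgue_measure R).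
Implicit Types (f g h : R -> R) (D : set (measurableTypeR R)).

Lemma integrable_bounded_mul f h (M : R) D : measurable D ->
  mu.-integrable D (EFin \o f) -> measurable_fun D h ->
  (forall x, D x -> `|h x| <= M) ->
  mu.-integrable D (EFin \o (fun x => f x * h x)).
Proof.
move=> mD fi mh hM.
have := integrableMl mD fi mh; apply.
by exists M; split; [exact: num_real|move=> N MN x Dx; exact: le_trans (hM _ Dx) (ltW MN)].
Qed.

Lemma integrable_continuous_mul f h (a b : R) D : measurable D ->
  D `<=` `[a, b] -> mu.-integrable D (EFin \o f) ->
  {within `[a, b], continuous h} ->
  mu.-integrable D (EFin \o (fun x => f x * h x)).
Proof.
move=> mD Dab fi ch.
have [M [_ HM]] := compact_bounded (continuous_compact ch (@segment_compact _ a b)).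
apply: (@integrable_bounded_mul _ _ (M + 1)) => //.
  apply: measurable_funS Dab _ => //.
  by apply: subspace_continuous_measurable_fun.
by move=> x /Dab abx; apply: HM; [rewrite ltrDl ltr01|exists x].
Qed.

Lemma integrable_continuous h (a b : R) D : measurable D ->
  D `<=` `[a, b] -> {within `[a, b], continuous h} ->
  mu.-integrable D (EFin \o h).
Proof.
move=> mD Dab ch.
have : mu.-integrable `[a, b] (EFin \o h).
  exact: (@continuous_compact_integrable R h _ (@segment_compact _ a b)).
by apply: integrableS.
Qed.

Lemma integrable_scale f (k : R) D : measurable D ->
  mu.-integrable D (EFin \o f) ->
  mu.-integrable D (EFin \o (fun x => k * f x)).
Proof. by move=> mD fi; have := integrableZl mD k fi. Qed.

Lemma integrable_add f g D : measurable D ->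
  mu.-integrable D (EFin \o f) -> mu.-integrable D (EFin \o g) ->
  mu.-integrable D (EFin \o (fun x => f x + g x)).
Proof. by move=> mD fi gi; have := integrableD mD fi gi. Qed.

Lemma integrable_sub f g D : measurable D ->
  mu.-integrable D (EFin \o f) -> mu.-integrable D (EFin \o g) ->
  mu.-integrable D (EFin \o (fun x => f x - g x)).
Proof. by move=> mD fi gi; have := integrableB mD fi gi. Qed.

Lemma Rintegral_lincomb f g (k l : R) D : measurable D ->
  mu.-integrable D (EFin \o f) -> mu.-integrable D (EFin \o g) ->
  \int[mu]_(x in D) (k * f x - l * g x) =
  k * \int[mu]_(x in D) f x - l * \int[mu]_(x in D) g x.
Proof.
move=> mD fi gi.
have kfi := integrable_scale k mD fi; have lgi := integrable_scale l mD gi.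
by rewrite RintegralB// !RintegralZl.
Qed.

Lemma integrableT_restrict f D : measurable D ->
  mu.-integrable D (EFin \o f) <-> mu.-integrable setT (EFin \o (f \_ D)).
Proof. by move=> mD; rewrite integrable_mkcond// restrict_EFin. Qed.

Lemma integrable_subset f (D E : set (measurableTypeR R)) : measurable D -> measurable E ->
  E `<=` D -> mu.-integrable D (EFin \o f) -> mu.-integrable E (EFin \o f).
Proof. by move=> mD mE ED; apply: integrableS. Qed.

Lemma Rintegral_itv_split f (a x y : R) : a <= x -> x <= y ->
  mu.-integrable `[a, y] (EFin \o f) ->
  \int[mu]_(t in `[a, y]) f t - \int[mu]_(t in `[a, x]) f t =
  \int[mu]_(t in `[x, y]) f t.
Proof.
move=> ax xy fi; rewrite Rintegral_itvB//.
by rewrite Rintegral_itv_obnd_cbnd//; apply: integrable_subset fi => //; exact: subset_itvr.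
Qed.

End integrals.

(** * Smooth bumps, and test functions with a prescribed derivative *)

Section bump.
Context {R : realType}.
Notation mu := (@lebesgue_measure R).

Implicit Types (f h : R -> R).

(** The arguments are (n + 1)(x - s) and (n + 1)(t - x), in the form required by [smooth_affine]. On
    ]s, t[ both tend to infinity with [n], so both factors tend to 1; outside, one factor is 0. *)
Definition bump (s t : R) (n : nat) : R -> R :=
  (fun x => flat_fun 1 (n.+1%:R * x + - (n.+1%:R * s))) \*
  (fun x => flat_fun 1 (- n.+1%:R * x + n.+1%:R * t)).

Lemma flat_fun1E (x : R) :
  flat_fun 1 x = if 0 < x then expR (- x^-1) else 0.
Proof. by rewrite /flat_fun hornerC mul1r. Qed.

Lemma flat_fun1_bound (x : R) : 0 <= flat_fun 1 x <= 1.
Proof.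
rewrite flat_fun1E; case: ifPn => x0; last by rewrite lexx ler01.
by rewrite expR_ge0 -expR0 ler_expR oppr_le0 invr_ge0 ltW.
Qed.

Lemma smooth_bump s t n : smooth (bump s t n).
Proof. by apply: smoothM; apply: smooth_affine; exact: smooth_flat_fun. Qed.

Lemma bump_bound s t n x : 0 <= bump s t n x <= 1.
Proof.
rewrite /bump/=.
set u := flat_fun _ _; set v := flat_fun _ _.
have /andP[u0 u1] : 0 <= u <= 1 := flat_fun1_bound _.
have /andP[v0 v1] : 0 <= v <= 1 := flat_fun1_bound _.
by rewrite mulr_ge0// mulr_ile1.
Qed.

Lemma bump_out s t n x : ~ (s < x < t) -> bump s t n x = 0.
Proof.
rewrite /bump/= => /negP; rewrite negb_and -!leNgt => /orP[xs|tx].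
  rewrite [X in X * _](_ : _ = 0) ?mul0r// flat_fun1E ifF//.
  by apply/negbTE; rewrite -leNgt subr_le0 ler_wpM2l.
rewrite [X in _ * X](_ : _ = 0) ?mulr0// flat_fun1E ifF//.
by apply/negbTE; rewrite -leNgt addrC mulNr subr_le0 ler_wpM2l.
Qed.

Lemma cvg_flat_fun1 (d : R) : 0 < d ->
  flat_fun 1 (n.+1%:R * d) @[n --> \oo] --> (1 : R).
Proof.
move=> d0.
rewrite (_ : (fun n => _) = (fun n : nat => expR (- (n.+1%:R^-1 * d^-1)))); last first.
  by apply/funext => n; rewrite flat_fun1E pmulr_rgt0 ?d0 ?invfM.
rewrite -[X in _ --> X](@expR0 R); apply: continuous_cvg; first exact: continuous_expR.
rewrite -oppr0 -(mul0r d^-1); apply: cvgN; apply: cvgM; last exact: cvg_cst.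
exact: cvg_harmonic.
Qed.

Lemma cvg_bump s t x : bump s t n x @[n --> \oo] --> (\1_(`]s, t[) x : R).
Proof.
have [xst|xst] := boolP (s < x < t); last first.
  rewrite indicE memNset; last by rewrite /= in_itv/=; exact/negP.
  rewrite (_ : (fun n => _) = cst 0); first exact: cvg_cst.
  by apply/funext => n; rewrite bump_out//; exact/negP.
rewrite indicE mem_set; last by rewrite /= in_itv.
have /andP[sx xt] := xst.
rewrite -(mulr1 (true%:R : R)).
apply: cvgM; under eq_fun.
- move=> n; rewrite -mulrBr; over.
- by apply: cvg_flat_fun1; rewrite subr_gt0.
- move=> n; rewrite mulNr addrC -mulrBr; over.
- by apply: cvg_flat_fun1; rewrite subr_gt0.
Qed.

(** Bumps thus stand in for indicators of intervals. Their values lie in [0, 1], so |f| dominates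
    the integrands. *)
Lemma cvg_Rintegral_bump (D : set (measurableTypeR R)) f s t : measurable D ->
  mu.-integrable D (EFin \o f) -> `]s, t[ `<=` D ->
  (\int[mu]_(x in D) (f x * bump s t n x)) @[n --> \oo] -->
    (\int[mu]_(x in `]s, t[) f x : R).
Proof.
move=> mD fi stD.
have mf : measurable_fun D f by apply/measurable_EFinP; exact: measurable_int fi.
have mb n : measurable_fun D (bump s t n).
  apply: measurable_funTS; apply: continuous_measurable_fun.
  exact/smooth_continuous/smooth_bump.
have [] := @dominated_convergence _ _ R mu D mD
  (fun n x => (f x * bump s t n x)%:E) (fun x => (f x * \1_(`]s, t[) x)%:E)
  (abse \o (EFin \o f)).
- by move=> n; apply/measurable_EFinP; exact: measurable_funM.
- by apply/measurable_EFinP; apply: measurable_funM => //; exact: measurable_indic.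
- apply: aeW => x Dx; apply: cvg_EFin; first exact: nearW.
  by apply: cvgM; [exact: cvg_cst|exact: cvg_bump].
- exact: integrable_abse.
- apply: aeW => x n Dx /=; rewrite lee_fin normrM ler_piMr//.
  by have /andP[b0 b1] := bump_bound s t n x; rewrite ger0_norm.
move=> fi1 _ H.
rewrite (_ : \int[mu]_(x in `]s, t[) f x = fine (\int[mu]_(x in D) (f x * \1_(`]s, t[) x)%:E)%E).
  apply: fine_cvg => //.
  rewrite fineK//.
  exact: integrable_fin_num fi1.
transitivity (\int[mu]_(x in (D `&` (`]s, t[%classic))) f x); first by rewrite (setIidr stD).
rewrite Rintegral_mkcondr.
apply: eq_Rintegral => x _.
by rewrite patchE indicE; case: ifP; rewrite ?mulr1 ?mulr0.
Qed.

(** The primitive from [a] is the witness: it vanishes to the left of [c], and the zero mean makes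
    it vanish to the right of [d]. *)
Lemma test_primitive (a b c d : R) h : a < c -> c <= d -> d < b ->
  smooth h -> (forall x, ~ (c < x < d) -> h x = 0) ->
  \int[mu]_(x in `]a, b[) h x = 0 ->
  exists2 eta : R -> R, test_function `]a, b[%classic eta & eta^`()%classic = h.
Proof.
move=> ac cd db sh h0 inth.
pose eta t := \int[mu]_(x in `[a, t]) h x.
have etal t : t <= c -> eta t = 0.
  move=> tc; rewrite /eta (@eq_Rintegral _ _ _ _ _ (cst 0)).
    by rewrite Rintegral_cst ?mul0r.
  move=> x; rewrite inE/= in_itv/= => /andP[ax xt].
  by apply: h0; apply/negP; rewrite negb_and -leNgt (le_trans xt).
have etar t : d <= t -> eta t = 0.
  move=> dt; rewrite /eta -[RHS]inth Rintegral_mkcond [RHS]Rintegral_mkcond.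
  congr (Rintegral _ _ _); apply/funext => x; rewrite !patchE.
  have [cxd|cxd] := boolP (c < x < d); last first.
    by rewrite h0 ?if_same//; exact/negP.
  have /andP[cx xd] := cxd.
  rewrite !mem_set//= in_itv/=.
    by rewrite (lt_trans ac)// (lt_trans xd).
  by rewrite (le_trans (ltW ac) (ltW cx)) (le_trans (ltW xd)).
have deta (x : R) : is_derive x 1 eta (h x).
  (* To the left of [c] the primitive is locally zero. Elsewhere a < x, and the upper end x + 1
     makes [x] an interior point for the fundamental theorem. *)
  have [xc|cx] := ltP x c.
    rewrite h0; last by apply/negP; rewrite negb_and -leNgt ltW.
    apply: (@near_eq_is_derive _ _ _ (cst 0 : R -> R)) => //.
    near=> y; rewrite etal//; near: y; exact: lt_le_nbhsl.
  have xx1 : x < x + 1 by rewrite ltrDl.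
  have hi : mu.-integrable `[a, x + 1] (EFin \o h).
    apply: (@integrable_continuous _ _ a (x + 1)) => //.
    exact/continuous_subspaceT/smooth_continuous.
  have [] := continuous_FTC1_closed xx1 hi (lt_le_trans ac cx)
    (@smooth_continuous _ _ sh x).
  move=> deta detah; apply: (DeriveDef deta).
  by rewrite -(@derive1E R R eta); exact: detah.
exists eta; last by apply/funext => x; rewrite derive1E derive_val.
have supp : [set x | eta x != 0] `<=` `[c, d].
  move=> x /=; apply: contra_neqT; rewrite in_itv/= negb_and -!ltNge => /orP[] xx.
    by rewrite etal// ltW.
  by rewrite etar// ltW.
have cl : closure [set x | eta x != 0] `<=` `[c, d].
  rewrite ((closure_id `[c, d]%classic).1 (@itv_closed _ R c d)).
  exact: closure_subset.
split.
- exact: (@smooth_primitive _ h).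
- apply: subclosed_compact cl; first exact: closed_closure.
  exact: segment_compact.
- apply: subset_trans cl _ => x /=; rewrite !in_itv/= => /andP[cx xd].
  by rewrite (lt_le_trans ac)// (le_lt_trans xd).
Unshelve. all: by end_near. Qed.

End bump.

(** * Functions orthogonal to all derivatives of test functions *)

Section du_bois_reymond.
Context {R : realType}.
Notation mu := (@lebesgue_measure R).
Implicit Types (f g eta : R -> R).

Lemma Rintegral_itvoo_cst (s t : R) : s <= t ->
  \int[mu]_(x in `]s, t[) (1 : R) = t - s.
Proof.
move=> st; rewrite Rintegral_cst// mul1r/= lebesgue_measure_itv/= lte_fin.
by case: ltgtP st => //= ->; rewrite subrr.
Qed.

Lemma integrable_mul_bump f s t n (D : set (measurableTypeR R)) : measurable D ->
  mu.-integrable D (EFin \o f) ->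
  mu.-integrable D (EFin \o (fun x => f x * bump s t n x)).
Proof.
move=> mD fi; apply: (@integrable_bounded_mul _ _ _ 1) => //.
  apply: measurable_funTS; apply: continuous_measurable_fun.
  exact/smooth_continuous/smooth_bump.
by move=> x _; have /andP[? ?] := bump_bound s t n x; rewrite ger0_norm.
Qed.

Lemma integrable_itv_cst (a b c : R) :
  mu.-integrable `]a, b[ (EFin \o (fun=> c : R)).
Proof.
apply: (@integrable_continuous _ _ a b) => //; first exact: subset_itv_oo_cc.
by apply: continuous_subspaceT => x; exact: cvg_cst.
Qed.

(** Two bumps, each weighted by the mass of the other, have a difference of mean zero, which is the
    derivative of a test function. As the bumps tend to indicators, orthogonality says that [f] has
    the same mean over any two intervals. *)
Lemma Rintegral_orthogonal_test f (a b : R) : a < b ->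
  mu.-integrable `]a, b[ (EFin \o f) ->
  (forall eta, test_function `]a, b[%classic eta ->
    \int[mu]_(x in `]a, b[) (f x * eta^`()%classic x) = 0) ->
  exists c : R, forall s t, a < s -> s < t -> t < b ->
    \int[mu]_(x in `]s, t[) f x = c * (t - s).
Proof.
move=> ab fi f0.
(* The middle third of ]a, b[ serves as a fixed reference interval; the constant is the mean of [f]
   over it. *)
pose s0 := (2 * a + b) / 3; pose t0 := (a + 2 * b) / 3.
have as0 : a < s0 by rewrite /s0; lra.
have s0t0 : s0 < t0 by rewrite /s0 /t0; lra.
have t0b : t0 < b by rewrite /t0; lra.
exists (\int[mu]_(x in `]s0, t0[) f x / (t0 - s0)) => s t as_ st tb.
have bi s' t' n : mu.-integrable `]a, b[ (EFin \o bump s' t' n).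
  have := @integrable_mul_bump (fun=> 1) s' t' n `]a, b[%classic.
  move=> /(_ (measurable_itv _) (integrable_itv_cst a b 1)).
  by congr (_.-integrable _ _); apply/funext => x /=; rewrite mul1r.
pose m s' t' n := \int[mu]_(x in `]a, b[) bump s' t' n x.
pose F s' t' n := \int[mu]_(x in `]a, b[) (f x * bump s' t' n x).
have mF n : m s0 t0 n * F s t n = m s t n * F s0 t0 n.
  pose h x := m s0 t0 n * bump s t n x - m s t n * bump s0 t0 n x.
  have sh : smooth h.
    rewrite (_ : h = (cst (m s0 t0 n) \* bump s t n) \+
                     (cst (- m s t n) \* bump s0 t0 n)).
      by apply: smoothD; (apply: smoothM; [exact: smooth_cst|exact: smooth_bump]).
    by apply/funext => x; rewrite /h/= mulNr.
  have [||||||eta teta etah] := @test_primitive R a b (Num.min s s0) (Num.max t t0) h.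
  - by rewrite lt_min as_.
  - by rewrite ge_min le_max (ltW st).
  - by rewrite gt_max tb.
  - exact: sh.
  - move=> x xst; rewrite /h !bump_out ?mulr0 ?subrr//.
      by move=> /andP[sx xt]; apply: xst; rewrite gt_min lt_max sx xt !orbT.
    by move=> /andP[sx xt]; apply: xst; rewrite gt_min lt_max sx xt.
  - by rewrite /h (Rintegral_lincomb _ _ (measurable_itv _) (bi _ _ n) (bi _ _ n)) mulrC subrr.
  have := f0 _ teta; rewrite etah /h.
  under eq_Rintegral do rewrite mulrBr mulrCA (mulrCA _ (m s t n)).
  have bif s' t' := @integrable_mul_bump f s' t' n _ (measurable_itv _) fi.
  rewrite (Rintegral_lincomb _ _ (measurable_itv _) (bif _ _) (bif _ _)).
  by move=> /eqP; rewrite subr_eq0 => /eqP.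
have mcvg s' t' : a < s' -> s' < t' -> t' < b -> m s' t' n @[n --> \oo] --> t' - s'.
  move=> as' st' tb'; rewrite -(Rintegral_itvoo_cst (ltW st')).
  rewrite (_ : m s' t' = fun n => \int[mu]_(x in `]a, b[) (1 * bump s' t' n x)).
    apply: cvg_Rintegral_bump => //; first exact: integrable_itv_cst.
    by apply: subset_itv; rewrite bnd_simp ltW.
  by apply/funext => n; apply: eq_Rintegral => x _; rewrite mul1r.
have Fcvg s' t' : a < s' -> s' < t' -> t' < b ->
    F s' t' n @[n --> \oo] --> \int[mu]_(x in `]s', t'[) f x.
  move=> as' st' tb'; apply: cvg_Rintegral_bump => //.
  by apply: subset_itv; rewrite bnd_simp ltW.
have H1 : (m s0 t0 \* F s t) n @[n --> \oo] -->
    (t0 - s0) * \int[mu]_(x in `]s, t[) f x.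
  by apply: cvgM; [exact: mcvg|exact: Fcvg].
have H2 : (m s t \* F s0 t0) n @[n --> \oo] -->
    (t - s) * \int[mu]_(x in `]s0, t0[) f x.
  by apply: cvgM; [exact: mcvg|exact: Fcvg].
have H3 : (m s0 t0 \* F s t) = (m s t \* F s0 t0) by apply/funext.
rewrite H3 in H1; have H4 : (t0 - s0) * \int[mu]_(x in `]s, t[) f x =
    (t - s) * \int[mu]_(x in `]s0, t0[) f x.
  by apply: cvg_unique H1 H2.
have d0 : t0 - s0 != 0 by rewrite subr_eq0 gt_eqF.
by apply: (mulfI d0); rewrite H4; field.
Qed.

(** The primitive of f - c is constant inside ]a, b[, so its derivative is 0. Lebesgue
    differentiation identifies this derivative with f - c almost everywhere, and the fundamental
    theorem does so at each point of continuity. *)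
Lemma Rintegral_constant_ae f (a b c : R) : a < b ->
  mu.-integrable `]a, b[ (EFin \o f) ->
  (forall s t, a < s -> s < t -> t < b ->
    \int[mu]_(x in `]s, t[) f x = c * (t - s)) ->
  {ae mu, forall x, a < x < b -> f x = c} /\
  (forall x, a < x < b -> {for x, continuous f} -> f x = c).
Proof.
move=> ab fi fc.
pose f0 := (fun x => f x - c) \_ `]a, b[.
have fci : mu.-integrable `]a, b[ (EFin \o (fun x => f x - c)).
  by apply: integrable_sub => //; exact: integrable_itv_cst.
have f0i : mu.-integrable setT (EFin \o f0).
  exact: (integrableT_restrict _ (measurable_itv _)).1 fci.
have f0iD D : measurable D -> mu.-integrable D (EFin \o f0).
  by move=> mD; apply: integrable_subset f0i.
pose P x := \int[mu]_(t in `[a, x]) f0 t.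
have f0E x : a < x < b -> f0 x = f x - c.
  by move=> axb; rewrite /f0 patchE mem_set//= in_itv.
have Pst s t : a < s -> s < t -> t < b -> P s = P t.
  move=> as_ st tb; apply/eqP; rewrite eq_sym -subr_eq0; apply/eqP.
  rewrite /P Rintegral_itv_split ?ltW//; last exact: f0iD.
  rewrite -Rintegral_itv_obnd_cbnd; last exact: f0iD.
  rewrite -Rintegral_itv_bndo_bndc; last exact: f0iD.
  have -> : \int[mu]_(x in `]s, t[) f0 x = \int[mu]_(x in `]s, t[) (f x - c).
    apply: eq_Rintegral => x; rewrite inE/= in_itv/= => /andP[sx xt]; apply: f0E.
    by rewrite (lt_trans as_)// (lt_trans xt).
  have stab : `]s, t[ `<=` `]a, b[%classic.
    by apply: subset_itv; rewrite bnd_simp ltW.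
  rewrite RintegralB//=; last 2 first.
  - exact: integrable_subset fi.
  - exact: integrable_itv_cst.
  rewrite fc// -[X in _ - X](_ : c * \int[mu]_(x in `]s, t[) 1 = _).
    by rewrite Rintegral_itvoo_cst ?ltW// subrr.
  rewrite -RintegralZl//; last exact: integrable_itv_cst.
  by apply: eq_Rintegral => x _; rewrite mulr1.
have dP x : a < x < b -> P^`()%classic x = 0.
  move=> /andP[ax xb]; rewrite derive1E.
  suff H : is_derive x 1 P 0 by rewrite derive_val.
  apply: (@near_eq_is_derive _ _ _ (cst (P x))) => //.
  near=> y => /=.
  have ay : a < y by near: y; exact: lt_nbhsr.
  have yb : y < b by near: y; exact: lt_nbhsl.
  by have [yx|yx|->//] := ltgtP y x; [rewrite (Pst y x)|rewrite (Pst x y)].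
split.
- have f0l : locally_integrable [set: R] f0.
    by have := integrable_locally measurableT f0i; rewrite patch_setT.
  have := @FTC1 R f0 (BLeft a) (fun y => f0iD _ (measurable_itv _)) f0l.
  apply: filterS; first exact: (ae_filter_ringOfSetsType mu).
  move=> x Hx /[dup] axb /andP[ax xb].
  have [_] : derivable P x 1 /\ P^`()%classic x = f0 x by exact: Hx.
  rewrite dP// f0E// => /esym/eqP.
  by rewrite subr_eq0 => /eqP.
- move=> x /[dup] axb /andP[ax xb] cf.
  have cf0 : {for x, continuous f0}.
    have H : \forall y \near x, f y - c = f0 y.
      near=> y; rewrite f0E//; apply/andP; split; near: y.
        exact: lt_nbhsr.
      exact: lt_nbhsl.
    rewrite /prop_for /continuous_at f0E//.
    apply: cvg_trans (near_eq_cvg H) _.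
    by apply: cvgB => //; exact: cvg_cst.
  have [_] := continuous_FTC1_closed xb (f0iD _ (measurable_itv _)) ax cf0.
  rewrite -/P dP// f0E// => /esym/eqP.
  by rewrite subr_eq0 => /eqP.
Unshelve. all: by end_near. Qed.

End du_bois_reymond.

(** * Integration by parts for a primitive of an integrable function *)

Section partition.
Context {R : realType}.

(* Bisection: halving the intervals n times divides the bound by 2 ^ n. *)
Lemma constant_of_product_increment (Z V : R -> R) (a b : R) : a <= b ->
  (forall x y, a <= x -> x <= y -> y <= b ->
    `|Z y - Z x| <= (y - x) * (V y - V x)) ->
  Z a = Z b.
Proof.
move=> ab ZV.
have H n x y : a <= x -> x <= y -> y <= b ->
    `|Z y - Z x| <= (y - x) * (V y - V x) * 2^-1 ^+ n.
  elim: n x y => [|n IH] x y ax xy yb; first by rewrite expr0 mulr1 ZV.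
  pose m := (x + y) / 2.
  have xm : x <= m by rewrite /m; lra.
  have my : m <= y by rewrite /m; lra.
  have := lerD (IH x m ax xm (le_trans my yb)) (IH m y (le_trans ax xm) my yb).
  move=> H; apply: le_trans (le_trans _ H) _.
    rewrite (_ : Z y - Z x = (Z m - Z x) + (Z y - Z m)); last by ring.
    exact: ler_normD.
  rewrite exprSr -!mulrDl mulrA le_eqVlt; apply/orP; left; apply/eqP.
  by rewrite /m; field.
apply/eqP; rewrite eq_sym -subr_eq0 -normr_le0.
have K : (b - a) * (V b - V a) * 2^-1 ^+ n @[n --> \oo] --> (0 : R).
  rewrite -[X in _ --> X](mulr0 ((b - a) * (V b - V a))).
  apply: cvgM; first exact: cvg_cst.
  by apply: cvg_expr; rewrite ger0_norm ?invr_ge0// invf_lt1// ltr1n.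
apply: (cvgr_to_ge K).
by apply: nearW => n; exact: H.
Qed.

End partition.

Section integration_by_parts_primitive.
Context {R : realType}.
Notation mu := (@lebesgue_measure R).
Implicit Types (f g h eta : R -> R).

Lemma le_normr_Rintegral_bound h k (D : set (measurableTypeR R)) : measurable D ->
  mu.-integrable D (EFin \o h) -> mu.-integrable D (EFin \o k) ->
  (forall x, D x -> `|h x| <= k x) ->
  `|\int[mu]_(x in D) h x| <= \int[mu]_(x in D) k x.
Proof.
move=> mD hi ki hk; rewrite (le_trans (le_normr_Rintegral mD hi))//.
apply: le_Rintegral => //; exact: integrable_norm hi.
Qed.

Lemma Rintegral_smooth_derive eta (x y : R) : smooth eta -> x <= y ->
  \int[mu]_(t in `[x, y]) eta^`()%classic t = eta y - eta x.
Proof.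
move=> sm; rewrite le_eqVlt => /predU1P[->|xy].
  by rewrite set_itv1 Rintegral_set1 subrr.
rewrite /Rintegral (@continuous_FTC2 _ _ eta)//.
- exact/continuous_subspaceT/smooth_continuous/smooth_derive.
- split=> [z _||]; first by case: (smooth_derivable z sm).
  + exact/cvg_at_right_filter/smooth_continuous.
  + exact/cvg_at_left_filter/smooth_continuous.
Qed.

(** The primitive of [g] need not be differentiable everywhere, so the product rule is replaced by
    an estimate: the defect [Z] of the formula on [a, x] has increments bounded by y - x times the
    increments of [V], which forces Z a = Z b. *)
Lemma Rintegral_by_parts_smooth g eta (a b : R) : a <= b ->
  mu.-integrable `[a, b] (EFin \o g) -> smooth eta ->
  \int[mu]_(x in `[a, b]) (g x * eta x) +
  \int[mu]_(x in `[a, b])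
    ((\int[mu]_(t in `[a, x]) g t) * eta^`()%classic x) =
  (\int[mu]_(x in `[a, b]) g x) * eta b.
Proof.
move=> ab gi sm.
pose G x := \int[mu]_(t in `[a, x]) g t.
have sub x y : a <= x -> x <= y -> y <= b -> `[x, y] `<=` `[a, b]%classic.
  by move=> ax xy yb; apply: subset_itvScc; rewrite bnd_simp.
have gI x y : a <= x -> x <= y -> y <= b -> mu.-integrable `[x, y] (EFin \o g).
  by move=> ax xy yb; apply: integrable_subset gi => //; exact: sub.
have ceta : {within `[a, b], continuous eta}.
  exact/continuous_subspaceT/smooth_continuous.
have cdeta : {within `[a, b], continuous eta^`()%classic}.
  exact/continuous_subspaceT/smooth_continuous/smooth_derive.
have cG : {within `[a, b], continuous G}.
  exact: parameterized_integral_continuous.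
have cI h x y : {within `[a, b], continuous h} -> a <= x -> x <= y -> y <= b ->
    mu.-integrable `[x, y] (EFin \o h).
  by move=> ch ax xy yb; apply: (integrable_continuous _ _ ch) => //; exact: sub.
(* [compact_bounded] yields bounds strictly above its constant only, hence M + 1; the value at [a]
   shows that it is nonnegative. *)
have [M M0 HM] : exists2 M, 0 <= M &
    forall x, a <= x <= b -> `|eta^`()%classic x| <= M.
  have [M [_ HM]] := compact_bounded (continuous_compact cdeta (@segment_compact _ a b)).
  have HM1 x : a <= x <= b -> `|eta^`()%classic x| <= M + 1.
    by move=> axb; apply: HM; [rewrite ltrDl ltr01|exists x].
  exists (M + 1) => //.
  by apply: le_trans (HM1 a _); rewrite ?lexx.
have lip x y : a <= x -> x <= y -> y <= b -> `|eta y - eta x| <= M * (y - x).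
  move=> ax xy yb.
  have [c /[!in_itv]/= /andP[xc cy] ->] := @MVT_segment R eta eta^`()%classic x y xy
    (fun z _ => smooth_derivable z sm) (continuous_subspaceT (smooth_continuous sm)).
  rewrite normrM [`|y - x|]ger0_norm ?subr_ge0// ler_wpM2r ?subr_ge0//.
  by apply: HM; rewrite (le_trans ax xc) (le_trans cy yb).
pose A x := \int[mu]_(t in `[a, x]) (g t * eta t).
pose B x := \int[mu]_(t in `[a, x]) (G t * eta^`()%classic t).
pose Z x := A x + B x - G x * eta x.
(* The increment of [Z] splits into two terms, each at most M (y - x) times the integral of |g| over
   [x, y]; hence 2 M. *)
pose V x := 2 * M * \int[mu]_(t in `[a, x]) `|g t|.
have geI h x y : {within `[a, b], continuous h} -> a <= x -> x <= y -> y <= b ->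
    mu.-integrable `[x, y] (EFin \o (fun t => g t * h t)).
  move=> ch ax xy yb; apply: (integrable_continuous_mul _ _ (gI _ _ ax xy yb) ch) => //.
  exact: sub.
have nI x y : a <= x -> x <= y -> y <= b ->
    mu.-integrable `[x, y] (EFin \o (fun t => `|g t|)).
  by move=> ax xy yb; exact: integrable_norm (gI _ _ ax xy yb).
suff ZV : Z a = Z b.
  move: ZV; rewrite /Z /A /B /G set_itv1 !Rintegral_set1 mul0r addr0 subr0.
  by move=> /esym/eqP; rewrite subr_eq0 => /eqP.
apply: (constant_of_product_increment (V := V)) => // x y ax xy yb.
have aa := lexx a; have ay := le_trans ax xy.
have cc (c : R) : {within `[a, b], continuous (fun=> c : R)}.
  by apply: continuous_subspaceT => z; exact: cvg_cst.
have ce : {within `[a, b], continuous (fun t => eta t - eta y)}.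
  by move=> z; apply: cvgB; [exact: ceta|exact: cc].
have cGx : {within `[a, b], continuous (fun t => G t - G x)}.
  by move=> z; apply: cvgB; [exact: cG|exact: cc].
have ch : {within `[a, b], continuous (fun t => (G t - G x) * eta^`()%classic t)}.
  by move=> z; apply: cvgM; [exact: cGx|exact: cdeta].
have cGe : {within `[a, b], continuous (fun t => G t * eta^`()%classic t)}.
  by move=> z; apply: cvgM; [exact: cG|exact: cdeta].
have E1 : \int[mu]_(t in `[x, y]) (g t * (eta t - eta y)) =
    A y - A x - (G y - G x) * eta y.
  rewrite /A /G !Rintegral_itv_split//; [|exact: gI|exact: geI].
  rewrite -RintegralZr//; last exact: gI.
  rewrite -RintegralB//; last 2 first.
  - exact: geI.
  - by apply: geI.
  by apply: eq_Rintegral => t _; rewrite mulrBr.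
have E2 : \int[mu]_(t in `[x, y]) ((G t - G x) * eta^`()%classic t) =
    B y - B x - G x * (eta y - eta x).
  rewrite /B Rintegral_itv_split//; last exact: cI.
  rewrite -Rintegral_smooth_derive// -RintegralZl//; last exact: cI.
  rewrite -RintegralB//; last 2 first.
  - exact: cI.
  - by apply: integrable_scale => //; exact: cI.
  by apply: eq_Rintegral => t _; rewrite mulrBl.
(* Centring [eta] at the right end and [G] at the left end absorbs the increment of the product G
   eta exactly, and makes one factor small in each integral. *)
have -> : Z y - Z x = \int[mu]_(t in `[x, y]) (g t * (eta t - eta y)) +
    \int[mu]_(t in `[x, y]) ((G t - G x) * eta^`()%classic t).
  by rewrite E1 E2 /Z; ring.
have W0 : V y - V x = 2 * M * \int[mu]_(t in `[x, y]) `|g t|.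
  by rewrite /V -mulrBr Rintegral_itv_split//; exact: nI.
set W := \int[mu]_(t in `[x, y]) `|g t| in W0.
rewrite W0 (le_trans (ler_normD _ _))//.
rewrite (_ : (y - x) * _ = M * (y - x) * W + W * M * (y - x)); last by ring.
apply: lerD.
- rewrite /W -RintegralZl//; last exact: nI.
  apply: le_normr_Rintegral_bound => //; first exact: geI.
    by apply: integrable_scale => //; exact: nI.
  move=> t /=; rewrite in_itv/= => /andP[xt ty].
  rewrite normrM mulrC ler_wpM2r// distrC (le_trans (lip _ _ _ _ _))//.
    exact: le_trans xt.
  by rewrite ler_wpM2l// lerB.
- rewrite -[X in _ * X](_ : \int[mu]_(t in `[x, y]) 1 = _); last first.
    rewrite Rintegral_cst// mul1r/= lebesgue_measure_itv/= lte_fin.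
    by case: ltgtP xy => //= ->; rewrite subrr.
  rewrite -RintegralZl//; last exact: cI.
  apply: le_normr_Rintegral_bound => //; first exact: cI.
    by apply: integrable_scale => //; exact: cI.
  move=> t /=; rewrite in_itv/= => /andP[xt ty].
  rewrite mulr1 normrM ler_pM//; last first.
    by apply: HM; rewrite (le_trans ax xt) (le_trans ty yb).
  have tb := le_trans ty yb; have at_ := le_trans ax xt.
  rewrite /G Rintegral_itv_split//; last exact: gI.
  rewrite (le_trans (le_normr_Rintegral _ _))//; first exact: gI.
  rewrite -subr_ge0 /W Rintegral_itv_split//; last exact: nI.
  by apply: Rintegral_ge0 => z _.
Qed.

End integration_by_parts_primitive.

(** * The du Bois-Reymond lemma *)

Section du_bois_reymond.
Context {R : realType}.
Notation mu := (@lebesgue_measure R).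
Implicit Types (f g h eta : R -> R).

Lemma Rintegral_itvoo_itvcc h (a b : R) : mu.-integrable `[a, b] (EFin \o h) ->
  \int[mu]_(x in `]a, b[) h x = \int[mu]_(x in `[a, b]) h x.
Proof.
move=> hi; rewrite Rintegral_itv_bndo_bndc; last first.
  by apply: integrable_subset hi => //; exact: subset_itv_oo_cc.
rewrite Rintegral_itv_obnd_cbnd//.
by apply: integrable_subset hi => //; exact: subset_itv_oc_cc.
Qed.

Lemma within_itv_continuous h (a b x : R) : {within `[a, b], continuous h} ->
  a < x < b -> {for x, continuous h}.
Proof.
move=> ch /[dup] axb /andP[ax xb].
have [+ _ _] := (continuous_within_itvP h (lt_trans ax xb)).1 ch.
by apply; rewrite in_itv/= ax xb.
Qed.

Lemma test_function_smooth (D : set R) eta : test_function D eta -> smooth eta.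
Proof. by case. Qed.

Lemma test_function_out (D : set R) eta x : test_function D eta -> ~ D x ->
  eta x = 0.
Proof.
move=> [_ _ supp] Dx; apply: contra_notP Dx => /eqP etax.
by apply: supp; exact: subset_closure.
Qed.

Lemma integrable_mul_smooth f eta (a b : R) : smooth eta ->
  mu.-integrable `]a, b[ (EFin \o f) ->
  mu.-integrable `]a, b[ (EFin \o (fun x => f x * eta x)).
Proof.
move=> seta fi; apply: (integrable_continuous_mul (a := a) (b := b)) => //.
  exact: subset_itv_oo_cc.
exact/continuous_subspaceT/smooth_continuous.
Qed.

(** The hypothesis says f' = g weakly. As [eta] vanishes at [b], integration by parts turns the
    integral of g eta into minus that of G eta', with G a primitive of [g]; so f - G is orthogonal
    to every eta' and is a constant. *)
Lemma du_bois_reymond f g (a b : R) : a < b ->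
  mu.-integrable `]a, b[ (EFin \o f) -> mu.-integrable `]a, b[ (EFin \o g) ->
  (forall eta, test_function `]a, b[%classic eta ->
    \int[mu]_(x in `]a, b[) (f x * eta^`()%classic x) +
    \int[mu]_(x in `]a, b[) (g x * eta x) = 0) ->
  exists H : R -> R,
    [/\ {within `[a, b], continuous H},
      forall x y, a <= x -> x <= y -> y <= b ->
        H y - H x = \int[mu]_(t in `]x, y[) g t,
      {ae mu, forall x, a < x < b -> f x = H x} &
      forall x, a < x < b -> {for x, continuous f} -> f x = H x].
Proof.
move=> ab fi gi fg.
(* The extension by 0 is integrable on every measurable set, in particular on the closed intervals
   of the parts formula. *)
pose g0 := g \_ `]a, b[.
have g0i : mu.-integrable setT (EFin \o g0).
  exact: (integrableT_restrict _ (measurable_itv _)).1 gi.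
have g0iD D : measurable D -> mu.-integrable D (EFin \o g0).
  by move=> mD; apply: integrable_subset g0i.
pose G x := \int[mu]_(t in `[a, x]) g0 t.
have cG : {within `[a, b], continuous G}.
  by apply: parameterized_integral_continuous; [exact: ltW|exact: g0iD].
have Gi h : {within `[a, b], continuous h} -> mu.-integrable `]a, b[ (EFin \o h).
  by move=> ch; apply: (integrable_continuous _ _ ch) => //; exact: subset_itv_oo_cc.
have fGi : mu.-integrable `]a, b[ (EFin \o (fun x => f x - G x)).
  by apply: integrable_sub => //; exact: Gi.
have [|c Hc] := Rintegral_orthogonal_test ab fGi.
  move=> eta teta.
  have seta := test_function_smooth teta.
  have sdeta := smooth_derive seta.
  have etab : eta b = 0.
    by apply: (test_function_out teta); rewrite /= in_itv/= ltxx andbF.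
  have := Rintegral_by_parts_smooth (ltW ab) (g0iD _ (measurable_itv _)) seta.
  rewrite etab mulr0 -/G => /eqP; rewrite addr_eq0 => /eqP ibp.
  under eq_Rintegral do rewrite mulrBl.
  have cGeta : {within `[a, b], continuous (fun x => G x * eta^`()%classic x)}.
    move=> z; apply: cvgM; first exact: cG.
    exact/continuous_subspaceT/smooth_continuous.
  rewrite RintegralB//; last 2 first.
  - exact: integrable_mul_smooth.
  - exact: Gi.
  rewrite [X in _ - X]Rintegral_itvoo_itvcc; last first.
    by apply: (integrable_continuous _ _ cGeta).
  rewrite -[X in _ - X]opprK -ibp opprK -(fg _ teta); congr (_ + _).
  rewrite -Rintegral_itvoo_itvcc; last first.
    apply: (integrable_continuous_mul (a := a) (b := b)) => //; first exact: g0iD.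
    exact/continuous_subspaceT/smooth_continuous.
  by apply: eq_Rintegral => x xab; rewrite /g0 patchE xab.
have [Hae Hcont] := Rintegral_constant_ae ab fGi Hc.
exists (fun x => G x + c); split.
- by move=> z; apply: cvgD; [exact: cG|exact: cvg_cst].
- move=> x y ax xy yb; rewrite (_ : G y + c - (G x + c) = G y - G x); last by ring.
  rewrite /G Rintegral_itv_split//; last exact: g0iD.
  rewrite -Rintegral_itvoo_itvcc; last exact: g0iD.
  apply: eq_Rintegral => t; rewrite inE/= in_itv/= => /andP[xt ty].
  by rewrite /g0 patchE mem_set//= in_itv/= (le_lt_trans ax xt) (lt_le_trans ty yb).
- apply: filterS Hae; first exact: (ae_filter_ringOfSetsType mu).
  by move=> x Hx axb; rewrite -(Hx axb) addrC subrK.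
- move=> x axb cf.
  have cGx : {for x, continuous G} := within_itv_continuous cG axb.
  have <- : f x - G x = c by apply: (Hcont x axb); exact: cvgB cf cGx.
  by rewrite addrC subrK.
Qed.

End du_bois_reymond.

(** * The odd power function, its inverse and its continuity *)

Section signed_power.
Context {R : realType}.
Implicit Types (q r t s : R).

(** For q = p - 1 > 0 this is the flux |t|^(p-2) t. With the sign split off, the inverse has the
    same form, with exponent 1/q. *)
Definition spow q t : R := Num.sg t * `|t| `^ q.

Lemma normr_spow q t : 0 < q -> `|spow q t| = `|t| `^ q.
Proof.
move=> q0; rewrite /spow normrM [`|_ `^ _|]ger0_norm ?powR_ge0//.
have [->|t0] := eqVneq t 0; last by rewrite normr_sg t0 mul1r.
by rewrite normr0 powR0 ?gt_eqF// mulr0.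
Qed.

Lemma spowN q t : spow q (- t) = - spow q t.
Proof. by rewrite /spow sgrN normrN mulNr. Qed.

Lemma spow_gt0 q t : 0 < t -> spow q t = t `^ q.
Proof. by move=> t0; rewrite /spow gtr0_sg// mul1r gtr0_norm. Qed.

Lemma spow0 q : spow q 0 = 0.
Proof. by rewrite /spow sgr0 mul0r. Qed.

Lemma sgr_spow q t : Num.sg (spow q t) = Num.sg t.
Proof.
rewrite /spow sgrM sgr_id; have [->|t0] := eqVneq t 0; first by rewrite sgr0 mul0r.
by rewrite [X in _ * X]gtr0_sg ?mulr1// powR_gt0// normr_gt0.
Qed.

Lemma spowK q r : 0 < q -> q * r = 1 -> cancel (spow q) (spow r).
Proof.
move=> q0 qr t; rewrite {1}/spow sgr_spow normr_spow// -powRrM qr.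
by rewrite powRr1// mulr_sg_norm.
Qed.

Lemma spow_powR q t : 0 < q -> `|t| `^ (q - 1) * t = spow q t.
Proof.
move=> q0; have [->|t0] := eqVneq t 0; first by rewrite mulr0 spow0.
rewrite /spow {2}[t]numEsg mulrCA -[X in _ * X](mulrC `|t|).
by rewrite mulr_powRB1.
Qed.

Lemma ltr_spow q : 0 < q -> {homo spow q : s t / s < t}.
Proof.
move=> q0; have pos s t : 0 <= s -> s < t -> spow q s < spow q t.
  rewrite le_eqVlt => /predU1P[<- t0|s0 st].
    by rewrite spow0 spow_gt0// powR_gt0.
  have t0 := lt_trans s0 st.
  by rewrite !spow_gt0// gt0_ltr_powR// nnegrE ltW.
move=> s t st; have [s0|s0] := leP 0 s; first exact: pos.
have [t0|t0] := leP t 0.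
  by rewrite -ltrN2 -!spowN pos ?oppr_ge0// ltrN2.
rewrite (@lt_trans _ _ 0)//; last by rewrite spow_gt0// powR_gt0.
by rewrite -oppr_gt0 -spowN spow_gt0 ?powR_gt0// oppr_gt0.
Qed.

Lemma continuous_spow q : 0 < q -> continuous (spow q).
Proof.
move=> q0; have pos t : 0 < t -> {for t, continuous (spow q)}.
  move=> t0; have H : \forall s \near t, s `^ q = spow q s.
    by near=> s; rewrite spow_gt0//; near: s; exact: lt_nbhsr.
  have ct : {for t, continuous (fun s : R => s `^ q)}.
    apply/differentiable_continuous/derivable1_diffP.
    by apply: derivable_powR; rewrite in_itv/= t0.
  rewrite /prop_for /continuous_at spow_gt0//.
  exact: cvg_trans (near_eq_cvg H) ct.
move=> t; have [t0|t0|->] := ltgtP t 0; last 1 first.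
- rewrite /continuous_at spow0; apply/cvgrPdist_le => e e0.
  near=> s; rewrite sub0r normrN normr_spow//.
  (* Writing [e] as (e^(1/q))^q shows that |s| < e^(1/q) suffices. *)
  have := e0; rewrite -[e in _ -> _ <= e](powRr1 (ltW e0)).
  rewrite -[X in e `^ X](@mulVf _ q) ?gt_eqF// powRrM => _.
  rewrite ge0_ler_powR ?nnegrE ?powR_ge0// ?ltW//.
  near: s; apply: (@cvgr0_norm_lt _ _ _ _ _ id) => //.
  by rewrite powR_gt0.
- have -> : spow q = (fun s => - spow q (- s)).
    by apply/funext => s; rewrite spowN opprK.
  rewrite /continuous_at; apply: cvgN.
  apply: (@cvg_comp _ _ _ -%R (spow q) _ (nbhs (- t))).
    by apply: cvgN; exact: cvg_id.
  by apply: pos; rewrite oppr_gt0.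
- exact: pos.
Unshelve. all: by end_near. Qed.

End signed_power.

(** * Integrability from membership in L^q or L^oo on a bounded interval *)

Section Lebesgue_space.
Context {R : realType}.
Notation mu := (@lebesgue_measure R).
Implicit Types (f g h : R -> R) (a b : R).

Lemma Lebesgue_space_measurable (D : set (measurableTypeR R)) q h :
  measurable D -> Lebesgue_space D q h -> measurable_fun D h.
Proof.
move=> mD /sub_Lfun_mfun; rewrite inE/= => mh.
by apply/(measurable_restrictT _ mD).
Qed.

(** The majorant is 1 + |h|^q, integrable because the interval is bounded. The exponents of interest
    are r = 1 for u' and r = p - 1 for the flux. *)
Lemma Lebesgue_space_integrable_powR a b (q r : R) h : 1 <= q -> 0 <= r <= q ->
  Lebesgue_space `]a, b[%classic q%:E h ->
  mu.-integrable `]a, b[ (EFin \o (fun x => `|h x| `^ r)).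
Proof.
move=> q1 /andP[r0 rq] hq.
have mD : measurable (`]a, b[%classic : set (measurableTypeR R)) by [].
have mh := Lebesgue_space_measurable mD hq.
have := Lfun_integrable q1 hq => /(integrableS measurableT mD (@subsetT _ _)) hi.
have hi' := integrable_add mD (integrable_itv_cst a b 1) hi.
apply: (le_integrable mD _ _ hi').
  apply/measurable_EFinP.
  apply: (measurableT_comp (measurable_powR _)) => //.
  exact: measurableT_comp.
move=> x abx /=; rewrite lee_fin patchE mem_set//.
rewrite ger0_norm ?powR_ge0// [leRHS]ger0_norm ?addr_ge0 ?powR_ge0//.
have [h1|/ltW h1] := leP `|h x| 1.
  apply: (@le_trans _ _ (1 : R)); last by rewrite lerDl powR_ge0.
  have := ge0_ler_powR r0 (_ : `|h x| \in Num.nneg) (_ : (1 : R) \in Num.nneg) h1.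
  by rewrite powR1 !nnegrE; exact.
by rewrite (@le_trans _ _ (`|h x| `^ q))// ?lerDr// ler_powR.
Qed.

Lemma integrable_ae_bounded (D : set (measurableTypeR R)) f (M : R) :
  measurable D -> (mu D < +oo)%E -> measurable_fun D f ->
  {ae mu, forall x, D x -> `|f x| <= M} -> mu.-integrable D (EFin \o f).
Proof.
move=> mD muD mf fM.
apply/integrableP; split; first exact/measurable_EFinP.
apply: (@le_lt_trans _ _ (\int[mu]_(x in D) (cst `|M|%:E) x)%E).
  apply: ae_ge0_le_integral => //.
  - exact/measurable_EFinP/measurableT_comp.
  - by move=> x _; rewrite lee_fin.
  - apply: (@filterS _ _ (ae_filter_ringOfSetsType mu) _ _ _ fM).
    by move=> x fMx Dx /=; rewrite lee_fin (le_trans (fMx Dx))// ler_norm.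
by rewrite integral_cst// lte_mul_pinfty.
Qed.

Lemma Lebesgue_space_oo_integrable a b h :
  Lebesgue_space `]a, b[%classic +oo%E h -> mu.-integrable `]a, b[ (EFin \o h).
Proof.
move=> hoo.
have mD : measurable (`]a, b[%classic : set (measurableTypeR R)) by [].
have mh := Lebesgue_space_measurable mD hoo.
(* The L^oo norm unfolds to the essential supremum only when the whole space has positive measure; a
   unit interval shows that it does. *)
have muT : (0 < mu setT)%E.
  apply: (@lt_le_trans _ _ (mu `]0, 1[%classic)).
    by rewrite lebesgue_measure_itv/= lte_fin ltr01 -EFinB subr0 lte_fin.
  by apply: le_measure => //; rewrite inE.
have : (ess_sup mu (abse \o (EFin \o (h \_ `]a, b[))) < +oo)%E.
  have /sub_Lfun_finLfun := hoo; rewrite inE/= /finite_norm unlock/=.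
  by rewrite muT.
move=> essoo.
have [M hM] : exists M : R, {ae mu, forall x, `|(h \_ `]a, b[) x| <= M}.
  have [M esM] : exists M : R, (ess_sup mu (abse \o (EFin \o (h \_ `]a, b[))) <= M%:E)%E.
    case: (ess_sup _ _) essoo => [r _|//|_]; first by exists r.
    by exists 0; rewrite leNye.
  exists M; have /ess_supP HM := esM.
  apply: (@filterS _ _ (ae_filter_ringOfSetsType mu) _ _ _ HM).
  by move=> x; rewrite /= lee_fin.
apply: (@integrable_ae_bounded _ _ M) => //.
  by rewrite /= lebesgue_measure_itv/=; case: ifP => //= _; rewrite -EFinB ltry.
apply: (@filterS _ _ (ae_filter_ringOfSetsType mu) _ _ _ hM).
by move=> x + xab; rewrite patchE mem_set.
Qed.

End Lebesgue_space.

(** * Continuity and differentiability relative to a set *)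

Section within_continuity.
Context {R : realType}.

Lemma within_continuous_comp2 (phi : R -> R -> R) (u : R -> R) (A : set R) :
  {within A `*` [set: R], continuous (fun z : R * R => phi z.1 z.2)} ->
  {within A, continuous u} -> {within A, continuous (fun x => phi x (u x))}.
Proof.
move=> cphi cu; apply/subspace_continuousP => x Ax.
have /subspace_continuousP/(_ (x, u x) (conj Ax I)) /= phixu := cphi.
have /subspace_continuousP/(_ x Ax) ux := cu.
have xu : (y, u y) @[y --> within A (nbhs x)] --> (x, u x).
  have xx : y @[y --> within A (nbhs x)] --> x by exact: cvg_within.
  exact: (@cvg_pair _ _ _ (within A (nbhs x)) (nbhs x) (nbhs (u x)) _ _ _ _ _ xx ux).
apply: (@cvg_comp _ _ _ (fun y => (y, u y)) (fun z => phi z.1 z.2)) phixu => P.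
move=> /xu AP; apply: filterS2 (withinT A _) AP => y Ay; exact.
Qed.

Lemma continuously_differentiable_on_within (A : set R) (b : R -> R) :
  continuously_differentiable_on A b -> {within A, continuous b}.
Proof.
move=> [db _ dbE]; apply/subspace_continuousP => x Ax.
(* With error 1, the difference quotients near [x] are bounded by |db x| + 1, which gives continuity
   at [x]. *)
have /cvgrPdist_lt/(_ _ ltr01) := dbE x Ax; rewrite near_withinE => dbx.
apply/cvgrPdist_le => e e0; rewrite near_withinE.
have k0 : 0 < `|db x| + 1 by rewrite ltr_wpDl.
have xy : \forall y \near x, `|x - y| < e / (`|db x| + 1).
  have /cvgrPdist_lt := @cvg_id _ (nbhs x).
  by apply; exact: divr_gt0.
move: dbx; rewrite near_withinE.
apply: filterS2 xy => y xy; have [->|yx] := eqVneq y x.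
  by rewrite subrr normr0 ltW.
move=> /(_ isT) H Ay; have := H Ay; set q := (b y - b x) / (y - x) => dbq.
have -> : b x - b y = q * (x - y).
  by rewrite /q; field; rewrite subr_eq0.
rewrite normrM.
rewrite (@le_trans _ _ ((`|db x| + 1) * `|x - y|))//.
  rewrite ler_wpM2r// -[q](subrK (db x)) addrC (le_trans (ler_normD _ _))// lerD2l.
  by rewrite distrC ltW.
by rewrite mulrC -ler_pdivlMr// ltW.
Qed.

Lemma continuously_differentiable_on_derivable (a c : R) (b : R -> R) x :
  continuously_differentiable_on `[a, c] b -> a < x < c -> derivable b x 1.
Proof.
move=> [db _ dbE] /andP[ax xc].
have := dbE x; rewrite /= in_itv/= !ltW// => /(_ isT) bx.
apply/cvg_ex; exists (db x) => /=.
apply/cvgrPdist_lt => e e0.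
have /cvgrPdist_lt/(_ _ e0) := bx; rewrite 2!near_withinE => H.
have {}H : \forall y \near x, y != x -> `|db x - (b y - b x) / (y - x)| < e.
  near=> y => yx; suff : `[a, c]%classic y by apply: (near H y) => //.
  rewrite /= in_itv/= !ltW//; near: y; [exact: lt_nbhsl|exact: lt_nbhsr].
have /nbhs_ballP[d d0 Hd] := H.
apply/nbhs_ballP; exists d => //= h; rewrite /ball/= sub0r normrN => hd h0.
rewrite /GRing.scale/= mulr1.
have := Hd (h + x); rewrite /ball/= opprD addrCA subrr addr0 normrN => /(_ hd).
rewrite addrK mulrC; apply.
by rewrite -subr_eq0 addrK.
Unshelve. all: by end_near. Qed.

End within_continuity.

(** * Regularity of weak solutions *)

Section regularity.
Context {R : realType}.
Notation mu := (@lebesgue_measure R).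
Notation D := (`]-1, 1[%classic : set (measurableTypeR R)).

Lemma ae_eq_Rintegral (f g : R -> R) (E : set (measurableTypeR R)) :
  measurable E -> measurable_fun E f -> measurable_fun E g ->
  {ae mu, forall x, E x -> f x = g x} ->
  \int[mu]_(x in E) f x = \int[mu]_(x in E) g x.
Proof.
move=> mE mf mg fg; congr fine; apply: ae_eq_integral => //.
- exact/measurable_EFinP.
- exact/measurable_EFinP.
apply: (@filterS _ _ (ae_filter_ringOfSetsType mu) _ _ _ fg).
by move=> x H /H ->.
Qed.

Lemma continuous_primitive_is_derive (u h w : R -> R) (a b x : R) :
  {within `[a, b], continuous w} ->
  (forall x, a < x < b -> u x = h x) ->
  (forall x, a <= x <= b -> h x - h a = \int[mu]_(t in `[a, x]) w t) ->
  a < x < b -> is_derive x 1 u (w x).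
Proof.
move=> cw uh hw /[dup] axb /andP[ax xb].
have wi : mu.-integrable `[a, b] (EFin \o w) by exact: integrable_continuous cw.
have [dP dPx] := continuous_FTC1_closed xb wi ax (within_itv_continuous cw axb).
pose P y : R := \int[mu]_(t in `[a, y]) w t.
have dPw : is_derive x 1 P (w x).
  by apply: (DeriveDef dP); rewrite -(@derive1E R R P); exact: dPx.
have -> : w x = 0 + w x by rewrite add0r.
apply: (@near_eq_is_derive _ _ _ (cst (h a) + P)) => //.
near=> y; have ayb : a < y < b.
  by apply/andP; split; near: y; [exact: lt_nbhsr|exact: lt_nbhsl].
have /andP[ay yb] := ayb.
rewrite uh// -[RHS](subrK (h a)) addrC hw//.
by rewrite !ltW.
Unshelve. all: by end_near. Qed.

(** The du Bois-Reymond lemma is used twice: [u] is a primitive of [du], and the flux of [du] agrees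
    almost everywhere with a continuous primitive [Q] of phi - b du - f. Inverting the power makes
    [du] continuous up to a null set, hence [u] differentiable at every interior point. The last
    conclusion is the equation in integrated form, which holds up to the endpoints. *)
Lemma weak_solution_regular (p : R) (b f u : R -> R) (phi : R -> R -> R) :
  2 < p ->
  {within `[-1, 1], continuous b} ->
  {within `[-1, 1] `*` [set: R], continuous (fun z : R * R => phi z.1 z.2)} ->
  Lebesgue_space D +oo%E f ->
  weak_solution p b phi f u ->
  exists w : R -> R, [/\ {within `[-1, 1], continuous w},
    forall x : R, -1 < x < 1 -> is_derive x 1 u (w x) &
    forall x y : R, -1 <= x -> x <= y -> y <= 1 ->
      spow (p - 1) (w y) - spow (p - 1) (w x) =
      \int[mu]_(t in `]x, y[) (phi t (u t) - b t * w t) -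
      \int[mu]_(t in `]x, y[) f t].
Proof.
move=> p2 cb cphi fL [cu [du [_ duL wdu] weak]].
have p1 : 1 <= p by rewrite ltW// (lt_trans _ p2)// ltr1n.
have q0 : 0 < p - 1 by rewrite subr_gt0 (lt_trans _ p2)// ltr1n.
have ab : (-1 : R) < 1 by lra.
have mD : measurable D by [].
have mdu := Lebesgue_space_measurable mD duL.
have oocc : D `<=` `[-1, 1]%classic by exact: subset_itv_oo_cc.
have fi := Lebesgue_space_oo_integrable fL.
have flux_r : 0 <= p - 1 <= p by rewrite ltW// gerBl ler01.
have dui : mu.-integrable D (EFin \o du).
  apply: (le_integrable mD _ _ (Lebesgue_space_integrable_powR p1 (_ : 0 <= 1 <= p) duL)).
  - exact/measurable_EFinP.
  - by move=> x _ /=; rewrite lee_fin powRr1// normr_id.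
  - by rewrite ler01.
have cspow : continuous (spow (p - 1)) by exact: continuous_spow.
have mflux : measurable_fun D (spow (p - 1) \o du).
  apply: measurableT_comp => //.
  exact: continuous_measurable_fun.
have fluxi : mu.-integrable D (EFin \o (spow (p - 1) \o du)).
  apply: (le_integrable mD _ _ (Lebesgue_space_integrable_powR p1 flux_r duL)).
  - exact/measurable_EFinP.
  - by move=> x _ /=; rewrite normr_spow// [X in (_ <= X%:E)%E]ger0_norm// powR_ge0.
have ui : mu.-integrable D (EFin \o u) by exact: integrable_continuous cu.
have cphiu := within_continuous_comp2 cphi cu.
have phiui : mu.-integrable D (EFin \o (fun x => phi x (u x))).
  exact: integrable_continuous cphiu.
have bdui : mu.-integrable D (EFin \o (fun x => b x * du x)).
  have := integrable_continuous_mul mD oocc dui cb.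
  by congr (_.-integrable _ _); apply/funext => x /=; rewrite mulrC.
pose k x := phi x (u x) - b x * du x - f x.
have ki0 : mu.-integrable D (EFin \o (fun x => phi x (u x) - b x * du x)).
  exact: integrable_sub.
have ki : mu.-integrable D (EFin \o k) by exact: integrable_sub.
have [H [cH HE _ uH]] : exists H : R -> R,
    [/\ {within `[-1, 1], continuous H},
      forall x y : R, -1 <= x -> x <= y -> y <= 1 ->
        H y - H x = \int[mu]_(t in `]x, y[) du t,
      {ae mu, forall x : R, -1 < x < 1 -> u x = H x} &
      forall x : R, -1 < x < 1 -> {for x, continuous u} -> u x = H x].
  apply: du_bois_reymond => // eta teta.
  by rewrite (wdu _ teta) addNr.
have [Q [cQ QE duQ _]] : exists Q : R -> R,
    [/\ {within `[-1, 1], continuous Q},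
      forall x y : R, -1 <= x -> x <= y -> y <= 1 ->
        Q y - Q x = \int[mu]_(t in `]x, y[) k t,
      {ae mu, forall x : R, -1 < x < 1 -> (spow (p - 1) \o du) x = Q x} &
      forall x : R, -1 < x < 1 -> {for x, continuous (spow (p - 1) \o du)} ->
        (spow (p - 1) \o du) x = Q x].
  apply: du_bois_reymond => // eta teta.
  have seta := test_function_smooth teta.
  have := weak _ teta.
  have -> : \int[mu]_(x in `]-1, 1[) (`|du x| `^ (p - 2) * du x * eta^`()%classic x) =
      \int[mu]_(x in `]-1, 1[) ((spow (p - 1) \o du) x * eta^`()%classic x).
    apply: eq_Rintegral => x _ /=; rewrite -(spow_powR _ q0).
    by congr (_ `^ _ * _ * _); lra.
  have -> : \int[mu]_(x in `]-1, 1[) (k x * eta x) =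
      \int[mu]_(x in `]-1, 1[) (phi x (u x) * eta x) -
      \int[mu]_(x in `]-1, 1[) (b x * du x * eta x) -
      \int[mu]_(x in `]-1, 1[) (f x * eta x).
    rewrite -RintegralB//; last 2 first.
    - exact: integrable_mul_smooth.
    - exact: integrable_mul_smooth.
    rewrite -RintegralB//; last 2 first.
    - have := integrable_mul_smooth seta ki0.
      by congr (_.-integrable _ _); apply/funext => x /=; rewrite mulrBl.
    - exact: integrable_mul_smooth.
    by apply: eq_Rintegral => x _; rewrite /k !mulrBl.
  by move=> <-; ring.
(* [Q] is the continuous version of the flux; the inverse power recovers from it a continuous
   version of u'. *)
pose w := spow (p - 1)^-1 \o Q.
have wK : cancel (spow (p - 1)^-1) (spow (p - 1)).
  by apply: spowK; rewrite ?invr_gt0// mulVf// gt_eqF.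
have Kw : cancel (spow (p - 1)) (spow (p - 1)^-1).
  by apply: spowK => //; rewrite mulfV// gt_eqF.
have cw : {within `[-1, 1], continuous w}.
  move=> x; apply: (@continuous_comp (subspace _) R R Q) (cQ x) _.
  by apply: continuous_spow; rewrite invr_gt0.
have duw : {ae mu, forall x : R, -1 < x < 1 -> du x = w x}.
  apply: (@filterS _ _ (ae_filter_ringOfSetsType mu) _ _ _ duQ).
  by move=> x /= duQx xab; rewrite /w/= -duQx// Kw.
have wI : mu.-integrable D (EFin \o w) by exact: integrable_continuous cw.
have mw : measurable_fun D w.
  by apply/measurable_EFinP; exact: measurable_int wI.
have ooD x y : -1 <= x -> y <= 1 -> (`]x, y[%classic : set (measurableTypeR R)) `<=` D.
  by move=> x1 y1; apply: subset_itv; rewrite bnd_simp.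
exists w; split => //.
- move=> x xab; apply: (continuous_primitive_is_derive cw _ _ xab) => [z zab|z].
    by apply: uH => //; exact: within_itv_continuous cu zab.
  move=> /andP[z1 z2]; rewrite HE// -Rintegral_itvoo_itvcc; last first.
    apply: (integrable_continuous _ _ cw) => //.
    by apply: subset_itvl; rewrite bnd_simp.
  apply: ae_eq_Rintegral => //.
  - by apply: measurable_funS mdu => //; exact: ooD.
  - by apply: measurable_funS mw => //; exact: ooD.
  apply: (@filterS _ _ (ae_filter_ringOfSetsType mu) _ _ _ duw).
  by move=> t duwt /(ooD _ _ (lexx _) z2); rewrite /= in_itv/=; exact: duwt.
- move=> x y x1 xy y1; rewrite /w/= !wK QE//.
  have bwi : mu.-integrable D (EFin \o (fun t => phi t (u t) - b t * w t)).
    apply: (integrable_continuous _ oocc) => // z.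
    by apply: cvgB; [exact: cphiu|apply: cvgM; [exact: cb|exact: cw]].
  have sub g : mu.-integrable D (EFin \o g) -> mu.-integrable `]x, y[ (EFin \o g).
    by apply: integrable_subset => //; exact: ooD.
  rewrite -RintegralB//; last 2 first.
  - exact: sub.
  - exact: sub.
  have meas g : mu.-integrable D (EFin \o g) -> measurable_fun `]x, y[ g.
    by move=> /sub /measurable_int /measurable_EFinP.
  apply: ae_eq_Rintegral => //.
  - exact: meas.
  - by apply: meas; exact: integrable_sub.
  apply: (@filterS _ _ (ae_filter_ringOfSetsType mu) _ _ _ duw).
  move=> t duwt /(ooD _ _ x1 y1); rewrite /= in_itv/= => /duwt dwt.
  by rewrite /k dwt.
Qed.

End regularity.

(** * Last zeros, and monotonicity from growth to the right *)

Section real_functions.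
Context {R : realType}.
Implicit Types (f g z D E : R -> R) (a b c x y : R).

Lemma within_continuous_comp (A B : set R) f g :
  {within B, continuous f} -> continuous g -> (forall x, A x -> B (g x)) ->
  {within A, continuous (f \o g)}.
Proof.
move=> /subspace_continuousP cf cg AB; apply/subspace_continuousP => x Ax P.
move=> /(cf _ (AB _ Ax)) fP.
have gP : \forall y \near x, B (g y) -> P (f (g y)) := cg x _ fP.
by apply: (filterS _ gP) => y H Ay; apply: H; exact: AB.
Qed.

(** The point is the supremum of the set where z <= 0. By continuity z <= 0 there, and the zero that
    the intermediate value theorem gives beyond it can only be the supremum itself. *)
Lemma last_zero z a x : a <= x -> {within `[a, x], continuous z} ->
  z a <= 0 -> 0 < z x ->
  exists s, [/\ a <= s, s < x, z s = 0 & forall t, s < t -> t <= x -> 0 < z t].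
Proof.
move=> ax cz za zx.
pose S := [set t | a <= t <= x /\ z t <= 0].
have Sa : S a by rewrite /S/= lexx ax.
have ubS : ubound S x by move=> t [/andP[_ +] _].
have supS : has_sup S by split; [exists a|exists x].
have leS t : S t -> t <= sup S by apply: ub_le_sup; exists x.
have sa : a <= sup S := leS _ Sa.
have sx : sup S <= x by apply: ge_sup => //; exists a.
have zs : z (sup S) <= 0.
  rewrite leNgt; apply/negP => zs.
  have /subspace_continuousP/(_ (sup S)) := cz.
  rewrite /= in_itv/= sa sx => /(_ isT) /(cvgr_gt _)/(_ 0 zs).
  rewrite near_withinE => /nbhs_ballP[e /= e0 He].
  have [t St st] := sup_adherent e0 supS.
  have ts := leS _ St.
  have [axt zt] := St.
  have : 0 < z t.
    apply: He; last by rewrite /= in_itv/=.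
    by rewrite /ball/= ger0_norm ?subr_ge0// ltrBlDr addrC -ltrBlDr.
  by rewrite ltNge zt.
have pos t : sup S < t -> t <= x -> 0 < z t.
  move=> st tx; rewrite ltNge; apply/negP => zt.
  have : t <= sup S by apply: leS; split => //; rewrite tx (le_trans sa)// ltW.
  by rewrite leNgt st.
have sx' : sup S < x.
  rewrite lt_neqAle sx andbT; apply: contraTneq zx => <-.
  by rewrite -leNgt.
exists (sup S); split => //.
have cz' : {within `[sup S, x], continuous z}.
  by apply: continuous_subspaceW cz; apply: subset_itvr; rewrite bnd_simp.
have [|c] := @IVT R z (sup S) x 0 sx cz'.
  by rewrite ge_min le_max zs (ltW zx) orbT.
rewrite in_itv/= => /andP[sc cx] zc.
have [//|cs] := eqVneq c (sup S); first by rewrite -zc => ->.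
have := pos c _ cx; rewrite zc ltxx lt_neqAle eq_sym cs sc.
by move=> /(_ isT).
Qed.

(** The multiplied-out inequality expresses that the lower right Dini derivative is at least [d]; in
    this form it also applies to functions that are not differentiable. *)
Lemma is_derive_right_growth E x d : is_derive x 1 E d ->
  forall e, 0 < e -> \forall y \near x^'+, (d - e) * (y - x) <= E y - E x.
Proof.
move=> [dE <-] e e0.
have /cvgrPdist_le/(_ _ e0) := dE; rewrite near_withinE => /nbhs_ballP[r /= r0 Hr].
near=> y.
have xy : x < y by near: y; exact: nbhs_right_gt.
have yx0 : 0 < y - x by rewrite subr_gt0.
have := Hr (y - x); rewrite /ball/= sub0r normrN gtr0_norm//.
have yr : y - x < r by rewrite ltrBlDr; near: y; apply: nbhs_right_lt; rewrite ltrDr.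
move=> /(_ yr); rewrite gt_eqF// => /(_ isT).
rewrite /GRing.scale/= mulr1 subrK -/('D_1 E x) => H.
rewrite -ler_pdivlMr// mulrC lerBlDl -lerBlDr.
exact: le_trans (ler_norm _) H.
Unshelve. all: by end_near. Qed.

(** After adding k t with k > 0, the function grows strictly to the right of every interior point,
    so a maximum over [c, b] can only lie at [b]. Taking c > a makes the left end [c] interior as
    well; [c] then tends to [a] by continuity. *)
Lemma right_growth_nondecreasing D a b : a <= b ->
  {within `[a, b], continuous D} ->
  (forall x, a < x < b -> forall e, 0 < e ->
    \forall y \near x^'+, - e * (y - x) <= D y - D x) ->
  D a <= D b.
Proof.
rewrite le_eqVlt => /predU1P[->//|ab] cD gD.
have H c : a < c -> c < b -> D c <= D b.
  move=> ac cb; apply/ler_addgt0Pr => e e0.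
  (* With this slope the correction over [c, b] amounts to exactly [e]. *)
  pose k := e / (b - c).
  have k0 : 0 < k by rewrite divr_gt0// subr_gt0.
  pose De t := D t + k * t.
  have cDe : {within `[c, b], continuous De}.
    move=> t; apply: cvgD.
      apply: (continuous_subspaceW _ cD).
      by apply: subset_itvr; rewrite bnd_simp ltW.
    apply: continuous_subspaceT => {}t.
    by apply: cvgM; [exact: cvg_cst|exact: cvg_id].
  have [s /[!in_itv]/= /andP[cs sb] smax] := EVT_max (ltW cb) cDe.
  have sbE : s = b.
    apply/eqP; rewrite eq_le sb/= leNgt; apply/negP => sltb.
    have asb : a < s < b by rewrite (lt_le_trans ac).
    have k20 : 0 < k / 2 by rewrite divr_gt0.
    (* A loss of k/2 leaves [De] a growth of at least (k/2)(y - s), against the maximality of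
       [s]. *)
    have [y []] : exists y, [/\ s < y, y < b & - (k / 2) * (y - s) <= D y - D s].
      near s^'+ => y; exists y; split; last by near: y; exact: gD.
        by near: y; exact: nbhs_right_gt.
      by near: y; exact: nbhs_right_lt.
    move=> sy yb Dy.
    have := smax y; rewrite in_itv/= (ltW yb) (le_trans cs (ltW sy)) => /(_ isT).
    rewrite /De; apply/negP; rewrite -ltNge.
    have : 0 < (k / 2) * (y - s) by rewrite mulr_gt0// subr_gt0.
    by move: Dy; lra.
  have := smax c; rewrite in_itv/= lexx (ltW cb) sbE /De => /(_ isT).
  have -> : e = k * (b - c) by rewrite /k divfK// subr_eq0 gt_eqF.
  by lra.
have [_ Da _] := (continuous_within_itvP D ab).1 cD.
apply: (cvgr_to_le Da); near=> y; apply: H; near: y.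
- exact: nbhs_right_gt.
- exact: nbhs_right_lt.
Unshelve. all: by end_near. Qed.

End real_functions.

(** * Growth of the energy, and the comparison argument *)

Section comparison.
Context {R : realType}.
Notation mu := (@lebesgue_measure R).

Lemma mvt_derivable_lower_bound (h : R -> R) (k s t : R) : s <= t ->
  (forall x, derivable h x 1) -> (forall x, k <= h^`()%classic x) ->
  k * (t - s) <= h t - h s.
Proof.
move=> st dh kh.
have ch : {within `[s, t], continuous h}.
  apply: continuous_subspaceT => x.
  exact/differentiable_continuous/derivable1_diffP.
have dh' x : x \in `]s, t[%R -> is_derive x 1 h (h^`()%classic x).
  by move=> _; rewrite derive1E; exact/derivableP.
have [x _ ->] := MVT_segment st dh' ch.
by rewrite ler_wpM2r// subr_ge0.
Qed.

(* The energy density (A u' - A v') (u - v) + b (u - v)^2 / 2 has lower right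
   Dini derivative at least (A u' - A v') (u' - v') where u > v. *)
Lemma energy_right_growth (F b z dz K : R -> R) (x k db : R) :
  is_derive x 1 K k -> is_derive x 1 b db -> is_derive x 1 z (dz x) ->
  0 <= k + b x * dz x + 2^-1 * db * z x ->
  0 < z x ->
  (\forall y \near x^'+, K y - K x <= F y - F x) ->
  forall e, 0 < e -> \forall y \near x^'+,
    (F x * dz x - e) * (y - x) <=
    (F y * z y + 2^-1 * b y * z y ^+ 2) - (F x * z x + 2^-1 * b x * z x ^+ 2).
Proof.
move=> dK db' dz' kz zx KF e e0.
pose d := F x * dz x + z x * (k + b x * dz x + 2^-1 * db * z x).
(* Up to a constant, this is the energy with F y replaced by F x + K y - K x. It is differentiable
   at [x], and its increment falls short of that of the energy by (F y - F x - (K y - K x)) z y >=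
   0. *)
pose E y := (K y - K x) * z y + F x * (z y - z x) + 2^-1 * (b y * (z y * z y)).
have dE : is_derive x 1 E d.
  rewrite (_ : E = (K - cst (K x)) * z + F x \*: (z - cst (z x)) +
      2^-1 \*: (b * (z * z))); last by [].
  have dKK : is_derive x 1 (K - cst (K x)) k.
    by apply: (is_derive_eq (is_deriveB dK (is_derive_cst _ _ _))); rewrite subr0.
  have dzz : is_derive x 1 (z - cst (z x)) (dz x).
    by apply: (is_derive_eq (is_deriveB dz' (is_derive_cst _ _ _))); rewrite subr0.
  have d1 := is_deriveM dKK dz'.
  have d2 := is_deriveZ (F x) dzz.
  have d3 := is_deriveZ 2^-1 (is_deriveM db' (is_deriveM dz' dz')).
  apply: (is_derive_eq (is_deriveD (is_deriveD d1 d2) d3)).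
  by rewrite /d /GRing.scale/= !fctE subrr; field.
have zpos : \forall y \near x^'+, 0 < z y.
  have cz : {for x, continuous z}.
    exact/differentiable_continuous/derivable1_diffP/(ex_derive (is_derive := dz')).
  exact/cvg_within/(cvgr_gt _ cz).
have gE := is_derive_right_growth dE e0.
near=> y.
have xy : x < y by near: y; exact: nbhs_right_gt.
have zy : 0 < z y by near: y.
have KFy : K y - K x <= F y - F x by near: y.
have Ey : (d - e) * (y - x) <= E y - E x by near: y.
rewrite [leRHS](_ : _ = E y - E x + (F y - F x - (K y - K x)) * z y); last first.
  by rewrite /E; field.
rewrite (@le_trans _ _ (E y - E x))//; last first.
  by rewrite lerDl mulr_ge0 ?subr_ge0// ltW.
apply: le_trans Ey; apply: ler_wpM2r; first by rewrite subr_ge0 ltW.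
rewrite lerD2r.
by rewrite /d lerDl mulr_ge0// ltW.
Unshelve. all: by end_near. Qed.


Lemma ae_le_Rintegral (f g : R -> R) (E : set (measurableTypeR R)) :
  measurable E -> mu.-integrable E (EFin \o f) -> mu.-integrable E (EFin \o g) ->
  {ae mu, forall x, E x -> f x <= g x} ->
  \int[mu]_(x in E) f x <= \int[mu]_(x in E) g x.
Proof.
move=> mE fi gi fg; rewrite -subr_ge0 -RintegralB//.
have mgf : measurable_fun E (fun x => g x - f x).
  by apply/measurable_EFinP; exact: measurable_int (integrable_sub mE gi fi).
(* The absolute value agrees with g - f almost everywhere and is nonnegative at every point. *)
rewrite (@ae_eq_Rintegral _ _ (fun x => `|g x - f x|))//.
- by apply: Rintegral_ge0 => x _.
- exact: measurableT_comp.
- apply: (@filterS _ _ (ae_filter_ringOfSetsType mu) _ _ _ fg).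
  by move=> x fgx Ex; rewrite ger0_norm// subr_ge0 fgx.
Qed.

End comparison.

Local Notation mu := (@lebesgue_measure _).

Theorem proposition2p1 (R : realType) (p : R) (b : R -> R)
    (phi : R -> R -> R) (f g u v : R -> R)
    (hp : 2 < p)
    (hb : continuously_differentiable_on `[-1, 1] b)
    (hphi : {within `[-1, 1] `*` [set: R],
      continuous (fun z : R * R => phi z.1 z.2)})
    (hdphi : forall x s : R, -1 <= x <= 1 -> derivable (phi x) s 1)
    (hdphi_cont : {within `[-1, 1] `*` [set: R],
      continuous (fun z : R * R => ((phi z.1)^`()) z.2)})
    (hbphi : forall x s : R, -1 < x < 1 ->
      0 <= 2^-1 * b^`()%classic x + (phi x)^`()%classic s)
    (hf : Lebesgue_space `]-1, 1[%classic +oo%E f)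
    (hg : Lebesgue_space `]-1, 1[%classic +oo%E g)
    (hfg : {ae @lebesgue_measure R, forall x, -1 < x < 1 -> f x <= g x})
    (hu : weak_solution p b phi f u)
    (hv : weak_solution p b phi g v)
    (huvl : u (-1) <= v (-1))
    (huvr : u 1 <= v 1) :
  forall x : R, -1 <= x <= 1 -> u x <= v x.
Proof.
have cb := continuously_differentiable_on_within hb.
have [cu _] := hu; have [cv _] := hv.
have [du [cdu dudu fluxu]] := weak_solution_regular hp cb hphi hf hu.
have [dv [cdv dvdv fluxv]] := weak_solution_regular hp cb hphi hg hv.
have q0 : 0 < p - 1 by lra.
pose z x := u x - v x; pose dz x := du x - dv x.
pose F x := spow (p - 1) (du x) - spow (p - 1) (dv x).
(* This is the continuous part of F', without [f] and [g]. The increments of F - K are the integrals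
   of g - f, hence nonnegative. *)
pose k x := (phi x (u x) - b x * du x) - (phi x (v x) - b x * dv x).
pose K x := \int[mu]_(t in `[-1, x]) k t.
have cz : {within `[-1, 1], continuous z}.
  by move=> x; apply: cvgB; [exact: cu|exact: cv].
have cphib (w dw : R -> R) : {within `[-1, 1], continuous w} ->
    {within `[-1, 1], continuous dw} ->
    {within `[-1, 1], continuous (fun x => phi x (w x) - b x * dw x)}.
  move=> cw cdw x; apply: cvgB; first exact: (within_continuous_comp2 hphi cw).
  by apply: cvgM; [exact: cb|exact: cdw].
have ck : {within `[-1, 1], continuous k}.
  by move=> x; apply: cvgB; exact: cphib.
have cspow (w : R -> R) : {within `[-1, 1], continuous w} ->
    {within `[-1, 1], continuous (fun x => spow (p - 1) (w x))}.
  move=> cw x; apply: (@continuous_comp (subspace _) R R w) (cw x) _.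
  exact: continuous_spow.
have cF : {within `[-1, 1], continuous F}.
  by move=> x; apply: cvgB; exact: cspow.
have sub x y : -1 <= x -> y <= 1 ->
    (`]x, y[%classic : set (measurableTypeR R)) `<=` `[-1, 1]%classic.
  by move=> x1 y1; apply: subset_itv; rewrite bnd_simp.
have sub2 x y : -1 <= x -> y <= 1 ->
    (`]x, y[%classic : set (measurableTypeR R)) `<=` `]-1, 1[%classic.
  by move=> x1 y1; apply: subset_itv; rewrite bnd_simp.
have fi := Lebesgue_space_oo_integrable hf.
have gi := Lebesgue_space_oo_integrable hg.
have KF x y : -1 <= x -> x <= y -> y <= 1 -> K y - K x <= F y - F x.
  move=> x1 xy y1.
  have ki : mu.-integrable `[-1, y] (EFin \o k).
    apply: (integrable_continuous _ _ ck) => //.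
    by apply: subset_itvl; rewrite bnd_simp.
  have phii (w dw : R -> R) : {within `[-1, 1], continuous w} ->
      {within `[-1, 1], continuous dw} ->
      mu.-integrable `]x, y[ (EFin \o (fun t => phi t (w t) - b t * dw t)).
    by move=> cw cdw; apply: (integrable_continuous _ _ (cphib _ _ cw cdw)) => //; exact: sub.
  rewrite /K Rintegral_itv_split// -Rintegral_itvoo_itvcc; last first.
    by apply: integrable_subset ki => //; apply: subset_itvr; rewrite bnd_simp.
  rewrite RintegralB//; last 2 first.
  - exact: phii.
  - exact: phii.
  have -> : F y - F x = (spow (p - 1) (du y) - spow (p - 1) (du x)) -
      (spow (p - 1) (dv y) - spow (p - 1) (dv x)) by rewrite /F; ring.
  rewrite fluxu// fluxv//.
  have fg : \int[mu]_(t in `]x, y[) f t <= \int[mu]_(t in `]x, y[) g t.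
    have sub' h : mu.-integrable `]-1, 1[ (EFin \o h) -> mu.-integrable `]x, y[ (EFin \o h).
      by apply: integrable_subset => //; exact: sub2.
    apply: ae_le_Rintegral => //; [exact: sub'|exact: sub'|].
    apply: (@filterS _ _ (ae_filter_ringOfSetsType mu) _ _ _ hfg).
    by move=> t fgt /(sub2 _ _ x1 y1); rewrite /= in_itv/=; exact: fgt.
  by move: fg; lra.
have dzdz (x : R) : -1 < x < 1 -> is_derive x 1 z (dz x).
  by move=> x1; apply: is_deriveB; [exact: dudu|exact: dvdv].
have dK (x : R) : -1 < x < 1 -> is_derive x 1 K (k x).
  move=> x1; apply: (continuous_primitive_is_derive (h := K) ck) => // y _.
  by rewrite {2}/K set_itv1 Rintegral_set1 subr0.
have db (x : R) : -1 < x < 1 -> is_derive x 1 b (b^`()%classic x).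
  move=> x1; rewrite derive1E; apply/derivableP.
  exact: continuously_differentiable_on_derivable hb x1.
(* The summand [b x * dz x] cancels the drift terms of [k x]. What remains is a lower bound - b'/2
   for the slope of [phi x] between [v x] and [u x]. *)
have kz x : -1 < x < 1 -> 0 < z x ->
    0 <= k x + b x * dz x + 2^-1 * b^`()%classic x * z x.
  move=> /[dup] x1 /andP[lx xr] zx.
  have uv : v x <= u x by rewrite -subr_ge0 ltW.
  have := mvt_derivable_lower_bound (h := phi x) (k := - (2^-1 * b^`()%classic x)) uv.
  have xx : -1 <= x <= 1 by rewrite !ltW.
  move=> /(_ (fun s => hdphi x s xx)) H.
  have {}H := H (fun s => _).
  rewrite /k /dz /z [leRHS](_ : _ = phi x (u x) - phi x (v x) -
    - (2^-1 * b^`()%classic x) * (u x - v x)); last by ring.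
  by rewrite subr_ge0 H// => s; rewrite lerNl -subr_ge0 opprK hbphi.
pose E x := F x * z x + 2^-1 * b x * z x ^+ 2.
have cE : {within `[-1, 1], continuous E}.
  move=> x; apply: cvgD; first by apply: cvgM; [exact: cF|exact: cz].
  apply: cvgM; last by apply: cvgM; exact: cz.
  by apply: cvgM; [exact: cvg_cst|exact: cb].
move=> x0 /andP[x0l x0r]; rewrite leNgt; apply/negP => uvx0.
have zx0 : 0 < z x0 by rewrite subr_gt0.
have [a [a1 ax0 za zpa]] : exists a, [/\ -1 <= a, a < x0, z a = 0 &
    forall t, a < t -> t <= x0 -> 0 < z t].
  apply: last_zero => //; last by rewrite subr_le0.
  by apply: continuous_subspaceW cz; apply: subset_itvl; rewrite bnd_simp.
have [c [c1 x0c zc zpc]] : exists c, [/\ c <= 1, x0 < c, z c = 0 &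
    forall t, x0 <= t -> t < c -> 0 < z t].
  (* The reflection t -> - t turns the first zero to the right of [x0] into a last zero to the left
     of [- x0]. *)
  have [||||s [s1 sx0 zs zps]] := @last_zero R (z \o -%R) (-1) (- x0).
  - by rewrite lerN2.
  - apply: (within_continuous_comp cz); first exact: opp_continuous.
    move=> t; rewrite /= !in_itv/=; lra.
  - by rewrite /= opprK subr_le0.
  - by rewrite /= opprK.
  exists (- s); split => //; [lra|lra|].
  move=> t x0t tc; rewrite -[t]opprK; apply: zps; lra.
have zpos t : a < t < c -> 0 < z t.
  move=> /andP[at_ tc]; have [tx|/ltW xt] := leP t x0; first exact: zpa.
  exact: zpc.
have ac : a < c := lt_trans ax0 x0c.
have int t : a < t < c -> -1 < t < 1.
  by move=> /andP[at_ tc]; rewrite (le_lt_trans a1)// (lt_le_trans tc).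
have growth t : a < t < c -> forall e, 0 < e ->
    \forall y \near t^'+, (F t * dz t - e) * (y - t) <= E y - E t.
  move=> atc; have t1 := int t atc; have /andP[_ tc] := atc.
  apply: (energy_right_growth (dK t t1) (db t t1) (dzdz t t1)).
  - exact: kz (zpos t atc).
  - exact: zpos.
  near=> y; have ty : t < y by near: y; exact: nbhs_right_gt.
  have yc : y < c by near: y; exact: nbhs_right_lt.
  apply: KF; [|exact: ltW|].
    by have /andP[/ltW] := t1.
  by rewrite (le_trans (ltW yc)).
have Fdz t : 0 <= F t * dz t.
  have [tt|tt|tt] := ltgtP (du t) (dv t).
  - rewrite nmulr_rge0; first by rewrite subr_le0 ltW.
    by rewrite subr_lt0 ltr_spow.
  - rewrite pmulr_rge0; first by rewrite subr_ge0 ltW.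
    by rewrite subr_gt0 ltr_spow.
  - by rewrite /dz tt subrr mulr0.
(* Growth is known inside ]a, c[ only; continuity of [E] carries the monotonicity to [a] and [c],
   which may be -1 and 1. *)
have Emono s t : a <= s -> s <= t -> t <= c -> E s <= E t.
  move=> as_ st tc; apply: right_growth_nondecreasing => //.
    apply: continuous_subspaceW cE; apply: subset_itvScc; rewrite bnd_simp.
      exact: le_trans as_.
    exact: le_trans c1.
  move=> x /andP[sx xt] e e0.
  have axc : a < x < c by rewrite (le_lt_trans as_)// (lt_le_trans xt).
  near=> y; have xy : x < y by near: y; exact: nbhs_right_gt.
  apply: (@le_trans _ _ ((F x * dz x - e) * (y - x))).
    by apply: ler_wpM2r; [rewrite subr_ge0 ltW|rewrite lerDr].
  by near: y; exact: growth.
have Ea : E a = 0 by rewrite /E za expr0n/= !mulr0 addr0.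
have Ec : E c = 0 by rewrite /E zc expr0n/= !mulr0 addr0.
(* As [z] rises from 0 at [a] to a positive value at [x0], some [xi] has z' > 0; there F > 0 by
   strict monotonicity of the power. *)
have [xi axi zxi] : exists2 xi, xi \in `]a, x0[%R & z x0 - z a = dz xi * (x0 - a).
  apply: MVT => //.
    move=> x; rewrite in_itv/= => /andP[ax xx0]; apply: dzdz; apply: int.
    by rewrite ax (lt_trans xx0).
  apply: continuous_subspaceW cz; apply: subset_itvScc; rewrite bnd_simp//.
move: axi; rewrite in_itv/= => /andP[axi xix0].
have dzxi : 0 < dz xi.
  by rewrite -(@pmulr_lgt0 _ (x0 - a)) ?subr_gt0// -zxi za subr0.
have Fxi : 0 < F xi by rewrite subr_gt0 ltr_spow// -subr_gt0.
pose m := F xi * dz xi.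
have m0 : 0 < m by rewrite mulr_gt0.
have xic : xi < c := lt_trans xix0 x0c.
have axic : a < xi < c by rewrite axi.
have m20 : 0 < m / 2 by rewrite divr_gt0.
(* A loss of m/2 still leaves a strict increase of [E] from [xi] to [y], which contradicts 0 = E a
   <= E xi and E y <= E c = 0. *)
have [y [xiy yc Ey]] : exists y,
    [/\ xi < y, y < c & (m - m / 2) * (y - xi) <= E y - E xi].
  near xi^'+ => y; exists y; split; last by near: y; exact: growth.
    by near: y; exact: nbhs_right_gt.
  by near: y; exact: nbhs_right_lt.
have := Emono a xi (lexx a) (ltW axi) (ltW xic).
have := Emono y c (ltW (lt_trans axi xiy)) (ltW yc) (lexx c).
have : 0 < (m - m / 2) * (y - xi) by rewrite mulr_gt0 ?subr_gt0//; lra.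
rewrite Ea Ec; lra.
Unshelve. all: by end_near. Qed.
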